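(* If $\alpha$ is a non-zero algebraic number, then the map $x\mapsto M_x(\alpha)$ is continuous on the positive real numbers.
   Context: $\overline{\mathbb Q}^\times$ is the multiplicative group of non-zero algebraic numbers. For $f(z)=a\prod_{n=1}^N(z-\alpha_n)\in\mathbb C[z]$ with $a\neq 0$, the (logarithmic) Mahler measure is $M(f)=\log|a|+\sum_{n=1}^N\log^+|\alpha_n|$, where $\log^+ t=\max\{\log t,0\}$ (and $\log^+0=0$). For $\alpha\in\overline{\mathbb Q}^\times$, $M(\alpha)$ denotes the Mahler measure of the minimal polynomial of $\alpha$ over $\mathbb Z$ (primitive, irreducible, with integer coefficients). For real $x>0$, the $x$-metric Mahler measure is $$M_x(\alpha)=\inf\left\{\left(\sum_{n=1}^\infty M(\alpha_n)^x\right)^{1/x}\right\},$$ the infimum being over all sequences $(\alpha_1,\alpha_2,\ldots)$ in $\overline{\mathbb Q}^\times$ with $\alpha_n=1$ for all but finitely many $n$ and $\prod_{n=1}^\infty\alpha_n=\alpha$. *)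

(* Defs.v *)
From HB Require Import structures.
From mathcomp Require Import all_boot all_order all_algebra.
From mathcomp Require Import complex.
From mathcomp Require Import all_classical all_reals all_analysis.
Set Implicit Arguments.
Unset Strict Implicit.
Unset Printing Implicit Defensive.
Import Order.TTheory GRing.Theory Num.Theory.
Import numFieldNormedType.Exports.
Local Open Scope classical_set_scope.
Local Open Scope ring_scope.

(* The field of complex numbers is R[i] for R : realType, and the algebraic
   numbers are its elements that are algebraic over the rationals. *)
Definition algebraic_unit (R : realType) (z : R[i]) : Prop :=
  z != 0 /\ algebraicOver (ratr : rat -> R[i]) z.

Definition cabs (R : realType) (z : R[i]) : R := complex.Re `|z|.

(* The library sets ln 0 = 0, so that logp 0 = 0. *)
Definition logp (R : realType) (t : R) : R := Num.max (ln t) 0.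

Definition complex_roots (R : realType) (f : {poly R[i]}) : seq R[i] :=
  sval (closed_field_poly_normal f).

(* Roots are listed with multiplicity; the value at f = 0 is meaningless. *)
Definition poly_mahler (R : realType) (f : {poly R[i]}) : R :=
  ln (cabs (lead_coef f)) + \sum_(z <- complex_roots f) logp (cabs z).

(* Over int, irreducible_poly is based on pseudo-division and hence ignores
   constant factors: together with primitivity it is irreducibility in Z[X].
   The condition zcontents p = 1 says that p is primitive and that its leading
   coefficient is positive, which makes p unique. *)
Definition is_min_poly (R : realType) (z : R[i]) (p : {poly int}) : Prop :=
  [/\ irreducible_poly p, zcontents p = 1
    & root (map_poly (intr : int -> R[i]) p) z].

(* The default value 0 is only reached when z is not algebraic. *)
Definition min_poly (R : realType) (z : R[i]) : {poly int} :=
  xget 0 [set p | is_min_poly z p].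

Definition mahler (R : realType) (z : R[i]) : R :=
  poly_mahler (map_poly (intr : int -> R[i]) (min_poly z)).

(* The index starts at 0 instead of 1. As a has only finitely many terms other
   than 1, its infinite product is the finitely supported \big over setT. *)
Definition factorization (R : realType) (alpha : R[i]) (a : nat -> R[i]) :
    Prop :=
  [/\ forall n, algebraic_unit (a n),
      finite_set [set n | a n != 1]
    & \big[*%R/1]_(n \in [set: nat]) a n = alpha].

(* The terms with a n = 1 vanish, because mahler 1 = 0 and 0 `^ x = 0 for x > 0,
   so the finitely supported sum over setT is the infinite sum. *)
Definition metric_mahler (R : realType) (x : R) (alpha : R[i]) : R :=
  inf [set (\sum_(n \in [set: nat]) mahler (a n) `^ x) `^ x^-1
      | a in [set a | factorization alpha a]].

(* Main.v *)
(* Given a factorization alpha = prod a_n, let L be a Galois number field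
   containing everything and K its normal closure of Q(alpha). Replace a_n by
   an r-th root g_n of b, where b is the product of the r conjugates of a_n over
   K. The polynomial F = (lead coefficient of a_n) * (minimal polynomial of b)
   has integer coefficients, and its roots are products over disjoint sets of
   conjugates of a_n. Hence M(g_n) <= M(F(X^r)) = M(F) <= M(a_n), and the product
   of the g_n is alpha up to a root of unity. As b lies in K, its degree is
   bounded in terms of alpha, so by Northcott and Kronecker there is c > 0
   depending only on alpha such that M(a_n) < c forces b to be a root of unity,
   and then M(g_n) = 0. Therefore the infimum may be taken over factorizations
   with a bounded number of factors of non-zero measure, and the comparison
   ||.||_y <= ||.||_x <= N^(1/x - 1/y) ||.||_y of l^x-norms, for x <= y, on
   vectors with at most N non-zero entries gives continuity. *)
From HB Require Import structures.
Require Import Defs.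
From mathcomp Require Import all_boot all_order all_algebra all_fingroup all_field.
From mathcomp Require Import complex.
From mathcomp Require Import all_classical all_reals all_analysis.
From mathcomp Require Import zify ring lra.
Set Implicit Arguments.
Unset Strict Implicit.
Unset Printing Implicit Defensive.
Import Order.TTheory GRing.Theory Num.Theory.
Import numFieldNormedType.Exports.
Local Open Scope classical_set_scope.
Local Open Scope ring_scope.

Local Notation ZtoC R p := (map_poly (intr : int -> R[i]) p).

(** * Algebraic integers dividing a leading coefficient *)

Definition Zintegral (L : fieldType) (z : L) := integralOver (intr : int -> L) z.

(** Multiplying [f.[z] = 0] by [c ^+ n.-1], with [c] the leading coefficient and [n] the degree,
    turns it into a monic equation for [c * z] whose coefficients are still integral. *)
Lemma Zintegral_lead_mul_root (L : fieldType) (f : {poly L}) (z : L) :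
  (forall i, Zintegral f`_i) -> root f z -> Zintegral (lead_coef f * z).
Proof.
move=> intf f_z; have [->|nz_f] := eqVneq f 0.
  by rewrite lead_coef0 mul0r; exact: mxpoly.integral0.
set c := lead_coef f; set n := (size f).-1.
have size_f : size f = n.+1 by rewrite prednK // lt0n size_poly_eq0.
have [n0|n_gt0] := posnP n.
  by have := root_size_gt1 nz_f f_z; rewrite size_f n0.
pose g := \poly_(i < n) (f`_i * c ^+ (n.-1 - i)) + 'X^n.
have size_g : (size (\poly_(i < n) (f`_i * c ^+ (n.-1 - i))%R) < size ('X^n : {poly L}))%N.
  by rewrite size_polyXn ltnS size_poly.
have g_monic : g \is monic.
  by rewrite monicE /g addrC lead_coefDl // lead_coefXn.
apply: (integral_root_monic g_monic).
  rewrite rootE /g hornerD hornerXn horner_poly.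
  apply/eqP; transitivity (c ^+ n.-1 * f.[z]); last by rewrite (eqP f_z) mulr0.
  rewrite horner_coef size_f big_ord_recr /= mulrDr mulr_sumr; congr (_ + _).
    apply: eq_bigr => i _; rewrite exprMn.
    have -> : c ^+ n.-1 = c ^+ (n.-1 - i) * c ^+ i.
      by rewrite -exprD subnK // -ltnS prednK.
    by rewrite [f`_i * _]mulrC mulrACA.
  by rewrite -[in LHS](prednK n_gt0) exprMn exprSr -mulrA prednK.
move=> a; have intg i : Zintegral g`_i.
  rewrite coefD coef_poly coefXn; apply: integral_add; last exact: integral_nat.
  case: ifP => _; last exact: mxpoly.integral0.
  apply: integral_mul; first exact: intf.
  elim: (n.-1 - i)%N => [|k IH]; first exact: integral1.
  by rewrite exprS; apply: integral_mul => //; exact: intf.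
by move=> /(nthP 0)[i _ <-]; exact: intg.
Qed.

(* Peels off the leading term of [g]: its product with [z] is integral, so
   [g - c X^n] satisfies the same hypothesis. *)
Lemma Zintegral_divXsubC (L : fieldType) (z : L) (g : {poly L}) :
  (forall i, Zintegral (('X - z%:P) * g)`_i) -> forall i, Zintegral g`_i.
Proof.
have [n] := ubnP (size g); elim: n g => // n IH g; rewrite ltnS => size_g intf.
have [->|nz_g] := eqVneq g 0; first by move=> i; rewrite coef0; exact: mxpoly.integral0.
set c := lead_coef g; set m := (size g).-1.
have cE : c = lead_coef (('X - z%:P) * g) by rewrite lead_coefM lead_coefXsubC mul1r.
have intc : Zintegral c by rewrite cE; exact: intf.
have intcz : Zintegral (c * z).
  by rewrite cE; apply: Zintegral_lead_mul_root => //; rewrite rootM root_XsubC eqxx.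
pose g' := g - c *: 'X^m.
have intg' : forall i, Zintegral g'`_i.
  apply: IH => [|i].
    apply: leq_trans size_g; rewrite -[X in (_ < X)%N](@prednK (size g)) ?lt0n ?size_poly_eq0 //.
    rewrite ltnS -/m; apply/leq_sizeP => j; rewrite leq_eqVlt => /orP[/eqP<-|lt_mj].
      by rewrite coefB coefZ coefXn eqxx mulr1 subrr.
    rewrite coefB coefZ coefXn gtn_eqF // mulr0 subr0 nth_default //.
    by rewrite -[size g]prednK // lt0n size_poly_eq0.
  rewrite mulrBr coefB; apply: integral_sub; first exact: intf.
  rewrite -scalerAr mulrBl -exprS scalerBr coefB !coefZ coefCM !coefXn mulrA.
  apply: integral_sub; apply: integral_mul => //; exact: integral_nat.
move=> i; rewrite -[g](subrK (c *: 'X^m)) coefD; apply: integral_add; first exact: intg'.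
by rewrite coefZ coefXn; apply: integral_mul => //; exact: integral_nat.
Qed.

Lemma perm_complement (T : eqType) (s t : seq T) :
  uniq t -> uniq s -> {subset s <= t} ->
  perm_eq t ([seq z <- t | z \notin s] ++ s).
Proof.
move=> uniq_t uniq_s s_t.
rewrite perm_sym perm_catC perm_sym -(perm_filterC (mem s) t) perm_cat2r.
apply: uniq_perm => //; first exact: filter_uniq.
by move=> z; rewrite mem_filter; apply/andP/idP => [[]|sz] //; split; [exact: sz | exact: s_t].
Qed.

(** Dividing out the roots outside [s] one at a time keeps the coefficients integral; what remains
    has the required product as constant coefficient, up to sign. *)
Lemma Zintegral_lead_prod_roots (L : fieldType) (c : L) (rs s : seq L) :
  (forall i, Zintegral (c *: \prod_(z <- rs) ('X - z%:P))`_i) ->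
  uniq rs -> uniq s -> {subset s <= rs} -> Zintegral (c * \prod_(z <- s) z).
Proof.
move=> int_rs uniq_rs uniq_s s_rs.
have perm_rs := perm_complement uniq_rs uniq_s s_rs.
have int_s : forall i, Zintegral (c *: \prod_(z <- s) ('X - z%:P))`_i.
  move: int_rs; rewrite (perm_big _ perm_rs) /= => {perm_rs}.
  elim: [seq _ <- _ | _] => [|z t IH] //= int_t; apply: IH.
  apply: (@Zintegral_divXsubC _ z) => i; rewrite -scalerAr.
  by move: (int_t i); rewrite big_cons.
have := int_s 0%N; rewrite coefZ -horner_coef0 horner_prod.
have -> : \prod_(z <- s) ('X - z%:P).[0] = (-1) ^+ size s * \prod_(z <- s) z.
  elim: (s) => [|z t IH]; first by rewrite !big_nil mulr1.
  by rewrite !big_cons IH hornerXsubC sub0r exprS mulrACA mulN1r.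
move=> H; have : Zintegral ((-1) ^+ size s * (c * ((-1) ^+ size s * \prod_(z <- s) z))).
  apply: integral_mul => //; elim: (size s) => [|k IH]; first exact: integral1.
  by rewrite exprS mulN1r; apply: integral_opp.
by rewrite mulrCA signrMK.
Qed.

(** Once the product is expanded, each coefficient is, up to sign, a sum of terms [c] times a
    subproduct of [bs]. Masks select by position, so the induction on [bs] only prepends a bit. *)
Lemma Zintegral_coef_prod_masks (L : fieldType) (c : L) (bs : seq L) :
  (forall m, Zintegral (c * \prod_(b <- mask m bs) b)) ->
  forall i, Zintegral (c *: \prod_(b <- bs) ('X - b%:P))`_i.
Proof.
elim: bs c => [|b bs IH] c int_m i.
  have := int_m [::]; rewrite !big_nil mulr1 => intc.
  by rewrite coefZ coef1; apply: integral_mul => //; exact: integral_nat.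
rewrite big_cons mulrBl scalerBr coefB mul_polyC scalerA.
apply: integral_sub; last first.
  by apply: IH => m; have := int_m (true :: m); rewrite /= big_cons mulrA.
rewrite scalerAr coefXM; case: eqP => _; first exact: mxpoly.integral0.
by apply: IH => m; exact: (int_m (false :: m)).
Qed.

(** The integers are integrally closed; the question is transferred to [algC], where rational
    algebraic integers are integers. *)
Lemma Zintegral_rat (L : fieldType) (f : {rmorphism rat -> L}) (q : rat) :
  Zintegral (f q) -> exists a : int, q = a%:~R.
Proof.
case=> p p_monic p_q.
have int_q : (ratr q : algC) \in Num.int.
  apply: Cint_rat_Aint; first by apply/CratP; exists q.
  apply: (@root_monic_Aint (map_poly intr p)); last 1 first.
  - by apply/polyOverP => i; rewrite coef_map /= intr_int.
  - have: root (map_poly intr p : {poly rat}) q.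
      rewrite -(fmorph_root f) -map_poly_comp.
      by rewrite (eq_map_poly (g := intr)) // => a /=; rewrite rmorph_int.
    rewrite -(fmorph_root (ratr : rat -> algC)) -map_poly_comp.
    by rewrite (eq_map_poly (g := intr)) // => a /=; rewrite rmorph_int.
  - exact: monic_map.
have /intrP[a Da] := int_q; exists a.
by apply: (fmorph_inj (ratr : rat -> algC)); rewrite rmorph_int.
Qed.

(** * Orbits of a normal subgroup of a Galois group *)

Lemma galois_number_field (L : splittingFieldType rat) (E : {subfield L}) :
  galois E {:L}.
Proof.
rewrite /galois subvf normalFieldf andbT; apply/separableP => y _.
by apply: pcharf0_separable => p; rewrite pchar_lalg; exact: pchar_num.
Qed.

(** The images are kept with multiplicity, one per element of [A], so that for a Galois group their
    product is a norm; [gal_block] is the orbit without repetitions. *)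
Definition gal_images (L : splittingFieldType rat) (A : {set gal_of {:L}})
  (y : L) : seq L := [seq (h : gal_of {:L}) y | h <- enum A].

Definition gal_block (L : splittingFieldType rat) (A : {set gal_of {:L}})
  (y : L) : seq L := undup (gal_images A y).

(** Here [g (h y) = (h ^ g) (g y)], and conjugation by an element of the normalizer permutes [A]. *)
Lemma gal_images_norm (L : splittingFieldType rat) (A : {group gal_of {:L}})
    (g : gal_of {:L}) (y : L) :
  g \in 'N(A)%g -> perm_eq (map g (gal_images A y)) (gal_images A (g y)).
Proof.
move=> gN; rewrite /gal_images -map_comp.
have -> : map (g \o (fun h : gal_of {:L} => h y)) (enum A) =
          map (fun h : gal_of {:L} => h (g y)) (map (fun h => (h ^ g)%g) (enum A)).
  rewrite -map_comp; apply: eq_map => h /=.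
  by rewrite -!galM ?memvf // -conjgC.
apply: perm_map; apply: uniq_perm; last 2 first.
- exact: enum_uniq.
- move=> h; rewrite mem_enum; apply/mapP/idP => [[k]|hA].
    by rewrite mem_enum => kA ->; rewrite memJ_norm.
  exists (h ^ g^-1)%g; last by rewrite conjgKV.
  by rewrite mem_enum memJ_norm // groupV.
- by rewrite map_inj_uniq ?enum_uniq //; exact: conjg_inj.
Qed.

Lemma gal_images_mem (L : splittingFieldType rat) (A : {group gal_of {:L}})
    (g : gal_of {:L}) (y : L) :
  g \in A -> perm_eq (gal_images A (g y)) (gal_images A y).
Proof.
move=> gA; rewrite /gal_images.
have -> : map (fun h : gal_of {:L} => h (g y)) (enum A) =
          map (fun h : gal_of {:L} => h y) (map (fun h => (g * h)%g) (enum A)).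
  by rewrite -map_comp; apply: eq_map => h /=; rewrite galM ?memvf.
apply: perm_map; apply: uniq_perm; last 2 first.
- exact: enum_uniq.
- move=> h; rewrite mem_enum; apply/mapP/idP => [[k]|hA].
    by rewrite mem_enum => kA ->; rewrite groupM.
  by exists (g^-1 * h)%g; rewrite ?mulKVg // mem_enum groupM // groupV.
- by rewrite map_inj_uniq ?enum_uniq //; exact: mulgI.
Qed.

Lemma gal_block_norm (L : splittingFieldType rat) (A : {group gal_of {:L}})
    (g : gal_of {:L}) (y : L) :
  g \in 'N(A)%g -> g (\prod_(w <- gal_block A y) w) = \prod_(w <- gal_block A (g y)) w.
Proof.
move=> gN; rewrite rmorph_prod -(big_map g xpredT id) /gal_block.
rewrite -(undup_map_inj (fmorph_inj _)); apply: perm_big; apply: perm_undup.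
by apply: perm_mem; exact: gal_images_norm.
Qed.

(** Serves twice: it makes the block product invariant under [A], and it shows that blocks with
    different products are disjoint. *)
Lemma gal_block_mem (L : splittingFieldType rat) (A : {group gal_of {:L}})
    (w y : L) :
  w \in gal_block A y -> \prod_(u <- gal_block A w) u = \prod_(u <- gal_block A y) u.
Proof.
rewrite mem_undup => /mapP[h]; rewrite mem_enum => hA ->.
by apply: perm_big; apply: perm_undup; apply: perm_mem; exact: gal_images_mem.
Qed.

(* Every point of an orbit is hit the same number of times. *)
Lemma gal_block_multiplicity (L : splittingFieldType rat)
    (A : {group gal_of {:L}}) (y : L) :
  exists t, (size (gal_block A y) * t = #|A|)%N /\
    (\prod_(w <- gal_block A y) w) ^+ t = \prod_(w <- gal_images A y) w.
Proof.
set r := gal_images A y; exists (count_mem y r).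
have count_r z : z \in gal_block A y -> count_mem z r = count_mem y r.
  rewrite mem_undup => /mapP[h]; rewrite mem_enum => hA ->.
  have /seq.permP <- : perm_eq (map h r) r.
    apply: perm_trans (gal_images_norm _ _) (gal_images_mem _ hA).
    exact: (fintype.subsetP (normG A)).
  rewrite count_map; apply: eq_count => w /=.
  exact: (inj_eq (fmorph_inj _)).
split.
  (* The images are regrouped by their distinct values, here with addition to count them and below
     with multiplication for the product. *)
  have := @big_undup_iterop_count _ 0%N addn _ r xpredT (fun=> 1%N).
  rewrite /= big_const_seq count_predT iter_addn_0 mul1n size_map -cardE => <-.
  rewrite big_seq (eq_bigr (fun=> count_mem y r)); last first.
    by move=> z /count_r ->; rewrite Monoid.iteropE /= iter_addn_0 mul1n.
  by rewrite -big_seq big_const_seq count_predT iter_addn_0 mulnC.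
rewrite -[RHS](@big_undup_iterop_count _ 1 *%R) /= -prodrXl big_seq [RHS]big_seq.
by apply: eq_bigr => z /count_r ->; rewrite Monoid.iteropE iter_mulr_1.
Qed.

Lemma flatten_uniq (T I : eqType) (B : I -> seq T) (s : seq I) :
  uniq s -> (forall i, i \in s -> uniq (B i)) ->
  {in s &, forall i j w, w \in B i -> w \in B j -> i = j} ->
  uniq (flatten (map B s)).
Proof.
elim: s => //= i s IH /andP[i_s uniq_s] uniq_B disj.
rewrite cat_uniq uniq_B ?mem_head // IH //.
- rewrite andbT; apply/hasPn => w /flatten_mapP[j js wj]; apply/negP => wi.
  have ij : i = j by apply: disj wi wj; rewrite ?mem_head // in_cons js orbT.
  by rewrite ij js in i_s.
- by move=> j js; apply: uniq_B; rewrite in_cons js orbT.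
- by move=> j k js ks; apply: disj; rewrite in_cons ?js ?ks orbT.
Qed.

Lemma uniq_map_inj_in (T I : eqType) (f : I -> T) (s : seq I) :
  uniq (map f s) -> {in s &, injective f}.
Proof.
elim: s => //= i s IH /andP[fi_s uniq_s] j k; rewrite !in_cons.
case/predU1P=> [->|js]; case/predU1P=> [->|ks] // fjk; last exact: IH.
- by rewrite fjk map_f in fi_s.
- by rewrite -fjk map_f in fi_s.
Qed.

(** [b] is the product of the orbit of [x] under the Galois group over [K], [r] the size of the
    orbit and [t] the order of the stabilizer. As [K] is normal, each conjugate of [b] is the
    product of the orbit of a conjugate of [x]; [B] lists one such orbit per conjugate of [b].
    Orbits that meet have equal products, so those in [B] are disjoint. *)
Lemma galois_block_factors (L : splittingFieldType rat) (K : {subfield L})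
    (x : L) :
  normalField 1 K ->
  exists rs, [/\ uniq rs, minPoly 1 x = \prod_(z <- rs) ('X - z%:P) &
  exists b r t (B : seq (seq L)),
  [/\ b \in K,
      (r * t = #|'Gal({:L} / K)%g|)%N,
      b ^+ t = \prod_(h in 'Gal({:L} / K)%g) (h : gal_of {:L}) x,
      minPoly 1 b = \prod_(u <- [seq \prod_(w <- s) w | s <- B]) ('X - u%:P) &
      uniq (flatten B) /\ {subset flatten B <= rs}]].
Proof.
move=> nK; pose H := 'Gal({:L} / K)%G.
have galL := galois_factors (subvf _) (@galois_number_field L 1%AS).
have [rx [rxG uniq_rx px]] := galL x (memvf x).
exists [seq (g : gal_of {:L}) x | g <- rx]; split=> //.
have [t [size_t prod_t]] := gal_block_multiplicity H x.
set b := \prod_(w <- gal_block H x) w in prod_t *.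
have [rb [rbG uniq_rb pb]] := galL b (memvf b).
have norm_H g : g \in 'Gal({:L} / 1)%g -> g \in 'N(H)%g.
  have nH : normal H 'Gal({:L} / 1)%g by apply: normalField_normal; rewrite ?sub1v ?subvf.
  by apply: (fintype.subsetP (normal_norm nH)).
have gb g : g \in rb -> g b = \prod_(w <- gal_block H (g x)) w.
  by move=> /(fintype.subsetP rbG) /norm_H gN; exact: (@gal_block_norm L H).
exists b, (size (gal_block H x)), t, [seq gal_block H ((g : gal_of {:L}) x) | g <- rb].
split=> //.
- have /galois_fixedField <- := galois_number_field K.
  apply/fixedFieldP; first exact: memvf.
  move=> g gH; rewrite /b (@gal_block_norm L H) ?(fintype.subsetP (normG _)) //.
  apply: (@gal_block_mem L H); rewrite mem_undup; apply/mapP; exists g => //.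
  by rewrite mem_enum.
- by rewrite prod_t big_map big_enum.
- rewrite pb -map_comp; congr (\prod_(u <- _) _).
  by apply/eq_in_map => g grb /=; rewrite gb.
split.
  apply: flatten_uniq.
  - by move: uniq_rb; apply: map_uniq.
  - by move=> g _; exact: undup_uniq.
  move=> g h grb hrb w wg wh; have : g b = h b.
    by rewrite !gb // -(@gal_block_mem L H _ _ wg) -(@gal_block_mem L H _ _ wh).
  exact: uniq_map_inj_in uniq_rb _ _ grb hrb.
move=> w /flatten_mapP[g grb]; rewrite mem_undup => /mapP[h]; rewrite mem_enum => hH ->.
rewrite -root_prod_XsubC -px -galM ?memvf //; apply: root_minPoly_gal; rewrite ?sub1v ?memvf //.
rewrite groupM ?(fintype.subsetP rbG _ grb) //.
exact: (fintype.subsetP (@galS _ _ 1%AS K _ (sub1v K)) h hH).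
Qed.

(** * Number fields inside the complex numbers *)

(** Iterates the primitive element theorem. The expression of [z] through [s] is recorded because it
    later places [z] in the field generated by [s]. *)
Lemma primitive_element_seq (C : numFieldType) (s : seq C) :
  {in s, forall x, algebraicOver (ratr : rat -> C) x} ->
  exists z : C, [/\ algebraicOver (ratr : rat -> C) z,
    exists a : seq nat, z = \sum_(u <- zip s a) u.1 *+ u.2 &
    exists ps : seq {poly rat}, s = [seq (map_poly ratr p).[z] | p <- ps]].
Proof.
elim: s => [|x s IH] alg_s.
  exists 0; split; first exact: algebraic0.
    by exists [::]; rewrite big_nil.
  by exists [::].
have [z [alg_z [a Dz] [ps Ds]]] := IH (fun y ys => alg_s y (mem_behead (s := x :: s) ys)).
have [rx nz_rx rx0] := alg_s x (mem_head _ _).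
(* The theorem produces a primitive element of the form [x *+ n - y]; taking [y = - z] keeps all
   multiplicities in [nat]. *)
have [rz nz_rz rz0] := algebraic_opp alg_z.
have [n [[pz Dpz] [px Dpx]]] := pchar0_PET nz_rz rz0 nz_rx rx0 (pchar_num _).
rewrite opprK in Dpz Dpx; exists (x *+ n + z); split.
- apply: algebraic_add => //; rewrite -mulr_natr; apply: algebraic_mul.
    exact: alg_s (mem_head _ _).
  by rewrite -(rmorph_nat (ratr : {rmorphism rat -> C})); exact: algebraic_id.
- by exists (n :: a); rewrite /= big_cons Dz.
exists (px :: [seq p \Po (- pz) | p <- ps]); rewrite /= Dpx; congr (_ :: _).
rewrite -map_comp {1}Ds; apply: eq_map => p /=.
by rewrite map_comp_poly horner_comp raddfN /= hornerN Dpz opprK.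
Qed.

(** A non-zero annihilating polynomial of least size is irreducible. *)
Lemma algebraic_irreducible (C : numFieldType) (z : C) (q : {poly rat}) :
  root (map_poly ratr q) z -> q != 0 ->
  exists r : {poly rat}, [/\ r != 0, root (map_poly ratr r) z & irreducible_poly r].
Proof.
move=> q_z nz_q.
pose P n := `[< exists r : {poly rat}, [/\ r != 0, root (map_poly ratr r) z & size r = n] >].
have exP : exists n, P n by exists (size q); apply/asboolP; exists q.
case: (ex_minnP exP) => n /asboolP[r [nz_r r_z <-]] min_r.
exists r; split=> //; apply/(subfx_irreducibleP r_z nz_r) => q0 q0_z nz_q0.
by apply: min_r; apply/asboolP; exists q0.
Qed.

(** [L] is generated by a primitive element [z] for the roots of [p]. As [z] is itself a combination
    of these roots, they generate [L], which is therefore a splitting field of [p]. *)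
Lemma splitting_field_embedding (C : numClosedFieldType) (p : {poly rat}) :
  p != 0 ->
  exists (L : splittingFieldType rat) (f : {rmorphism L -> C}),
    forall z, root (map_poly ratr p) z -> exists y, f y = z.
Proof.
move=> nz_p; have [s Dp] := closed_field_poly_normal (map_poly (ratr : rat -> C) p).
set c := lead_coef _ in Dp.
have nzc : c != 0 by rewrite lead_coef_eq0 map_poly_eq0.
have root_p z : root (map_poly ratr p) z = (z \in s).
  by rewrite Dp rootZ // root_prod_XsubC.
have alg_s : {in s, forall x, algebraicOver (ratr : rat -> C) x}.
  by move=> x; rewrite -root_p; exists p.
have [z [[q nz_q q_z] [a Dz] [ps Ds]]] := primitive_element_seq alg_s.
have [r [nz_r r_z irr_r]] := algebraic_irreducible q_z nz_q.
pose L0 := SubFieldExtType r_z irr_r.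
pose f : {rmorphism L0 -> C} := @subfx_inj _ _ (ratr : {rmorphism rat -> C}) z r.
pose z1 : L0 := subfx_root (ratr : {rmorphism rat -> C}) z r.
have f_z1 : f z1 = z by exact: subfx_inj_root.
have fE a0 : f a0%:A = ratr a0 by rewrite alg_num_field fmorph_rat.
pose inL := fieldExt_horner z1.
have f_inL q0 : f (inL q0) = (map_poly ratr q0).[z].
  rewrite /inL /= -horner_map f_z1 -map_poly_comp; congr _.[z].
  by apply: eq_map_poly => b /=; rewrite fE.
pose rs := map inL ps.
have f_rs : map f rs = s by rewrite /rs -map_comp Ds; apply: eq_map => q0 /=; exact: f_inL.
have z1_in : z1 \in <<1 & rs>>%VS.
  have -> : z1 = \sum_(u <- zip rs a) u.1 *+ u.2.
    apply: (fmorph_inj f); rewrite f_z1 Dz rmorph_sum -f_rs /=.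
    elim: (rs) (a) => [|w t IH] [|k b] /=; rewrite ?big_nil // !big_cons /= IH.
    by rewrite rmorphMn.
  have sum_in t b : {subset t <= <<1 & rs>>%VS} ->
      \sum_(u <- zip t b) u.1 *+ u.2 \in <<1 & rs>>%VS.
    elim: t b => [|w t IH] [|k b] sub_t /=; rewrite ?big_nil;  try exact: mem0v.
    rewrite big_cons; apply: rpredD; first by apply: rpredMn; apply: sub_t; exact: mem_head.
    by apply: IH => v vt; apply: sub_t; rewrite in_cons vt orbT.
  by apply: sum_in; exact: seqv_sub_adjoin.
have split_L0 : splitting_field_axiom L0.
  exists (map_poly (in_alg L0) p); first by apply/polyOver1P; exists p.
  exists rs.
    rewrite -(eqp_map f) -map_poly_comp (eq_map_poly (g := ratr)); last exact: fE.
    rewrite Dp rmorph_prod /= -f_rs big_map (eqp_ltrans (eqp_scale _ nzc)).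
    under [X in _ %= X]eq_bigr do rewrite map_polyXsubC.
    exact: eqpxx.
  apply/vspaceP => y; rewrite memvf.
  have [y0 ->] := subfxEroot r_z nz_r y.
  apply: rpred_horner; last exact: z1_in.
  by apply/polyOver_poly => i _; rewrite rpredZ ?mem1v.
pose L : splittingFieldType rat := HB.pack L0 (FieldExt_isSplittingField.Build _ L0 split_L0).
exists L, f => y; rewrite root_p -f_rs => /mapP[y0 _ ->]; by exists y0.
Qed.

(** * Mahler measure of complex and integer polynomials *)

Lemma cabsE (R : realType) (z : R[i]) : (cabs z)%:C%C = `|z|.
Proof. by rewrite /cabs RRe_real // normr_real. Qed.

Lemma cabs_ge0 (R : realType) (z : R[i]) : 0 <= cabs z.
Proof. by rewrite -lecR cabsE normr_ge0. Qed.

Lemma cabs0 (R : realType) : cabs (0 : R[i]) = 0.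
Proof. by rewrite /cabs normr0. Qed.

Lemma cabs_gt0 (R : realType) (z : R[i]) : z != 0 -> 0 < cabs z.
Proof. by move=> nz; rewrite -ltcR cabsE normr_gt0. Qed.

Lemma cabs1 (R : realType) : cabs (1 : R[i]) = 1.
Proof. by rewrite /cabs normr1. Qed.

Lemma cabsM (R : realType) (x y : R[i]) : cabs (x * y) = cabs x * cabs y.
Proof. by apply: (fmorph_inj (real_complex R)); rewrite rmorphM /= !cabsE normrM. Qed.

Lemma cabsX (R : realType) (x : R[i]) n : cabs (x ^+ n) = cabs x ^+ n.
Proof. by elim: n => [|n IH]; rewrite ?expr0 ?cabs1 // !exprS cabsM IH. Qed.

Lemma cabsD (R : realType) (x y : R[i]) : cabs (x + y) <= cabs x + cabs y.
Proof. by rewrite -lecR rmorphD /= !cabsE ler_normD. Qed.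

Lemma cabs_int (R : realType) (a : int) : cabs (a%:~R : R[i]) = `|a|%:~R.
Proof.
by apply: (fmorph_inj (real_complex R)); rewrite /= cabsE rmorph_int intr_norm.
Qed.

Lemma logp_ge0 (R : realType) (t : R) : 0 <= logp t.
Proof. by rewrite /logp le_max lexx orbT. Qed.

Lemma logp1 (R : realType) : logp (1 : R) = 0.
Proof. by rewrite /logp ln1 maxxx. Qed.

Lemma logp0 (R : realType) : logp (0 : R) = 0.
Proof. by rewrite /logp ln0 // maxxx. Qed.

Lemma logpM (R : realType) (s t : R) : 0 <= s -> 0 <= t -> logp (s * t) <= logp s + logp t.
Proof.
rewrite !le0r => /predU1P[->|s0]; first by rewrite mul0r logp0 add0r logp_ge0.
case/predU1P=> [->|t0]; first by rewrite mulr0 logp0 addr0 logp_ge0.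
rewrite /logp lnM ?posrE // ge_max; apply/andP; split.
  by apply: lerD; rewrite le_max lexx.
by apply: addr_ge0; exact: logp_ge0.
Qed.

Lemma logp_prod (R : realType) (s : seq R[i]) :
  logp (cabs (\prod_(z <- s) z)) <= \sum_(z <- s) logp (cabs z).
Proof.
elim: s => [|z s IH]; first by rewrite !big_nil cabs1 logp1.
rewrite !big_cons cabsM; apply: le_trans (logpM _ _) _; rewrite ?cabs_ge0 //.
by rewrite lerD2l.
Qed.

Lemma logpX (R : realType) (t : R) n : 0 <= t -> logp (t ^+ n) = logp t *+ n.
Proof.
rewrite le0r => /predU1P[->|t0].
  by case: n => [|n]; rewrite ?expr0 ?logp1 // exprS mul0r logp0 mul0rn.
rewrite /logp lnXn //; case: n => [|n]; first by rewrite maxxx.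
by case: (leP (ln t) 0) => [t_le|t_gt];
  [rewrite max_r ?mul0rn // mulrn_wle0 | rewrite max_l // mulrn_wge0 // ltW].
Qed.

(** Unique factorization makes the value independent of the list chosen by [complex_roots]. *)
Lemma poly_mahlerE (R : realType) (c : R[i]) (s : seq R[i]) : c != 0 ->
  poly_mahler (c *: \prod_(z <- s) ('X - z%:P)) =
  ln (cabs c) + \sum_(z <- s) logp (cabs z).
Proof.
move=> nzc; rewrite /poly_mahler /complex_roots.
case: closed_field_poly_normal => r /=.
rewrite lead_coefZ (monicP (monic_prod_XsubC _ _ _)) mulr1 => /(scalerI nzc) eq_sr.
by congr (_ + _); apply: perm_big; apply: prod_XsubC_eq.
Qed.

Lemma poly_mahler_roots (R : realType) (f : {poly R[i]}) :
  exists s, f = lead_coef f *: \prod_(z <- s) ('X - z%:P).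
Proof. by have [s Df] := closed_field_poly_normal f; exists s. Qed.

Lemma poly_mahlerM (R : realType) (f g : {poly R[i]}) : f != 0 -> g != 0 ->
  poly_mahler (f * g) = poly_mahler f + poly_mahler g.
Proof.
rewrite -lead_coef_eq0 -[g == 0]lead_coef_eq0 => nzf nzg.
have [s ->] := poly_mahler_roots f; have [t ->] := poly_mahler_roots g.
rewrite -scalerAl -scalerAr scalerA -big_cat /=.
rewrite !poly_mahlerE ?mulf_neq0 // cabsM lnM ?posrE ?cabs_gt0 // big_cat /=.
by rewrite addrACA.
Qed.

(** Each root [z] gives way to its [r] complex [r]-th roots, counted with multiplicity, and each of
    these has [logp] equal to [logp (cabs z) / r%:R]. *)
Lemma poly_mahler_comp_Xn (R : realType) (f : {poly R[i]}) r : (0 < r)%N ->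
  f != 0 -> poly_mahler (f \Po 'X^r) = poly_mahler f.
Proof.
move=> r_gt0; rewrite -lead_coef_eq0 => nzf; set c := lead_coef f in nzf *.
have [s ->] := poly_mahler_roots f; rewrite poly_mahlerE //.
rewrite -/c comp_polyZ rmorph_prod /=.
under eq_bigr do rewrite comp_polyB comp_polyX comp_polyC.
suff [t -> <-] : exists2 t, \prod_(z <- s) ('X^r - z%:P) = \prod_(z <- t) ('X - z%:P)
    & \sum_(z <- t) logp (cabs z) = \sum_(z <- s) logp (cabs z).
  by rewrite poly_mahlerE.
elim: s => [|z s [t Dt sum_t]]; first by exists [::]; rewrite !big_nil.
have [u Du] := poly_mahler_roots ('X^r - z%:P).
rewrite (monicP (monicXnsubC _ r_gt0)) scale1r in Du.
exists (u ++ t); rewrite ?big_cat !big_cons /= -?Du ?Dt //; congr (_ + _) => //.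
have size_u : size u = r.
  by apply/succn_inj; rewrite -[RHS](size_XnsubC z r_gt0) Du size_prod_XsubC.
have log_u w : w \in u -> logp (cabs w) = logp (cabs z) / r%:R.
  rewrite -root_prod_XsubC -Du rootE !hornerE subr_eq0 => /eqP wz.
  by rewrite -wz cabsX logpX ?cabs_ge0 // -[logp _ *+ _]mulr_natr mulfK // pnatr_eq0 -lt0n.
rewrite (eq_big_seq _ log_u) big_const_seq count_predT size_u iter_addr_0.
by rewrite -[(_ / _) *+ _]mulr_natr divfK // pnatr_eq0 -lt0n.
Qed.

Lemma size_ZtoC (R : realType) (p : {poly int}) : size (ZtoC R p) = size p.
Proof. by rewrite size_map_inj_poly //; exact: intr_inj. Qed.

Lemma ZtoC_eq0 (R : realType) (p : {poly int}) : (ZtoC R p == 0) = (p == 0).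
Proof. by rewrite -!size_poly_eq0 size_ZtoC. Qed.

Lemma lead_coef_ZtoC (R : realType) (p : {poly int}) :
  lead_coef (ZtoC R p) = (lead_coef p)%:~R.
Proof. by rewrite lead_coef_map_inj //; exact: intr_inj. Qed.

Lemma poly_mahler_int_ge0 (R : realType) (p : {poly int}) :
  p != 0 -> 0 <= poly_mahler (ZtoC R p).
Proof.
move=> nzp; apply: addr_ge0; last by apply: sumr_ge0 => z _; exact: logp_ge0.
rewrite lead_coef_ZtoC cabs_int ln_ge0 // ler1z -gtz0_ge1 normr_gt0.
by rewrite lead_coef_eq0.
Qed.

Lemma poly_mahler_dvd (R : realType) (p q : {poly int}) :
  p * q != 0 -> poly_mahler (ZtoC R p) <= poly_mahler (ZtoC R (p * q)).
Proof.
rewrite mulf_eq0 negb_or => /andP[nzp nzq].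
by rewrite rmorphM /= poly_mahlerM ?ZtoC_eq0 // lerDl poly_mahler_int_ge0.
Qed.

Lemma ZtoC_ratr (R : realType) (p : {poly int}) :
  map_poly (ratr : rat -> R[i]) (map_poly intr p) = ZtoC R p.
Proof.
by rewrite -map_poly_comp; apply: eq_map_poly => a /=; rewrite ratr_int.
Qed.

(** An irreducible rational annihilator of [z], cleared of denominators and of its content, has the
    required properties, so [xget] does not fall back on its default. *)
Lemma min_polyP (R : realType) (z : R[i]) :
  algebraicOver (ratr : rat -> R[i]) z -> is_min_poly z (min_poly z).
Proof.
case=> q0 nzq0 q0_z; have [r [nzr r_z irr_r]] := algebraic_irreducible q0_z nzq0.
have [q [a nza Dr]] := rat_poly_scale r.
have nzq : q != 0.
  by apply: contraNneq nzr => q_eq0; rewrite Dr q_eq0 rmorph0 scaler0.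
have Dq : q = zcontents q *: zprimitive q by exact: zpolyEprim.
have nzc : zcontents q != 0 by rewrite zcontents_eq0.
pose b : rat := a%:~R^-1 * (zcontents q)%:~R.
have nzb : b != 0 by rewrite mulf_neq0 // ?invr_eq0 intr_eq0.
have Dr' : r = b *: map_poly intr (zprimitive q).
  by rewrite Dr {1}Dq map_polyZ scalerA.
apply: (@xgetPex _ 0 [set p | is_min_poly z p]); exists (zprimitive q) => /=; split.
- apply/irreducible_rat_int; case: irr_r => size_r irr_r; split.
    by move: size_r; rewrite Dr' size_scale.
  move=> u size_u; rewrite -(dvdpZr _ _ nzb) -Dr' => /(irr_r _ size_u).
  by rewrite Dr'; move=> /eqp_trans; apply; exact: eqp_scale.
- by rewrite zcontents_primitive nzq.
- by move: r_z; rewrite Dr' map_polyZ rootZ ?fmorph_eq0 // ZtoC_ratr.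
Qed.

(** The rational gcd with [q] vanishes at [z], so by irreducibility it is the minimal polynomial up
    to a constant; primitivity then gives an integral quotient, by Gauss's lemma. *)
Lemma min_poly_dvd (R : realType) (z : R[i]) (q : {poly int}) :
  algebraicOver (ratr : rat -> R[i]) z -> root (ZtoC R q) z ->
  exists u, q = min_poly z * u.
Proof.
move=> alg_z q_z; have [irr_p cont_p p_z] := min_polyP alg_z.
set p := min_poly z in irr_p cont_p p_z *.
have -> : p = zprimitive p by rewrite [LHS]zpolyEprim cont_p scale1r.
suff /dvdpP_int[u ->] : p %| q by exists u.
rewrite -dvdp_rat_int; have /irreducible_rat_int[_ irr] := irr_p.
set P := map_poly _ p; set Q := map_poly _ q.
have /irr/eqp_dvdl <- : gcdp P Q %| P by exact: dvdp_gcdl.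
  exact: dvdp_gcdr.
apply: contraTneq q_z => size1; apply/negP => q_z.
have : root (map_poly (ratr : rat -> R[i]) (gcdp P Q)) z.
  by rewrite gcdp_map root_gcd !ZtoC_ratr p_z.
have /eqP/size_poly1P[c nzc ->] := size1.
by rewrite map_polyC rootC fmorph_eq0 (negPf nzc).
Qed.

(** The source of upper bounds for [mahler]: it suffices to exhibit an integer polynomial vanishing
    at [z], because the cofactor has non-negative measure. *)
Lemma mahler_le (R : realType) (z : R[i]) (q : {poly int}) :
  algebraicOver (ratr : rat -> R[i]) z -> q != 0 -> root (ZtoC R q) z ->
  mahler z <= poly_mahler (ZtoC R q).
Proof.
move=> alg_z nzq /(min_poly_dvd alg_z)[u Dq]; rewrite Dq.
by apply: poly_mahler_dvd; rewrite -Dq.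
Qed.

Lemma min_poly_neq0 (R : realType) (z : R[i]) :
  algebraicOver (ratr : rat -> R[i]) z -> min_poly z != 0.
Proof. by case/min_polyP=> irr _ _; exact: irredp_neq0. Qed.

Lemma mahler_ge0 (R : realType) (z : R[i]) :
  algebraicOver (ratr : rat -> R[i]) z -> 0 <= mahler z.
Proof. by move=> alg_z; apply: poly_mahler_int_ge0; exact: min_poly_neq0. Qed.

Lemma algebraic_int_root (R : realType) (z : R[i]) (q : {poly int}) :
  q != 0 -> root (ZtoC R q) z -> algebraicOver (ratr : rat -> R[i]) z.
Proof.
move=> nzq q_z; exists (map_poly intr q); last by rewrite ZtoC_ratr.
by rewrite map_poly_eq0_id0 ?intr_eq0 ?lead_coef_eq0.
Qed.

Lemma algebraic_unity_root (R : realType) (z : R[i]) n :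
  (0 < n)%N -> z ^+ n = 1 -> algebraic_unit z.
Proof.
move=> n_gt0 zn; split.
  by apply: contraPneq zn => ->; rewrite expr0n gtn_eqF // => /esym/eqP; rewrite oner_eq0.
apply: (@algebraic_int_root _ _ ('X^n - 1)).
  by rewrite monic_neq0 // -[1]/(1%:P) monicXnsubC.
by rewrite rmorphB /= map_polyXn rmorph1 rootE !hornerE zn subrr.
Qed.

(** ['X^n - 1] vanishes at [z], and composition with ['X^n] gives it the measure 0 of ['X - 1]. *)
Lemma mahler_unity_root (R : realType) (z : R[i]) n :
  (0 < n)%N -> z ^+ n = 1 -> mahler z = 0.
Proof.
move=> n_gt0 zn; have [_ alg_z] := algebraic_unity_root n_gt0 zn.
have nz : ('X^n - 1 : {poly int}) != 0 by rewrite monic_neq0 // -[1]/(1%:P) monicXnsubC.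
apply/le_anti; rewrite mahler_ge0 // andbT.
apply: le_trans (mahler_le alg_z nz _) _.
  by rewrite rmorphB /= map_polyXn rmorph1 rootE !hornerE zn subrr.
rewrite rmorphB /= map_polyXn rmorph1.
have -> : 'X^n - 1 = ('X - 1%:P) \Po 'X^n :> {poly R[i]}.
  by rewrite comp_polyB comp_polyX comp_polyC.
rewrite poly_mahler_comp_Xn ?polyXsubC_eq0 //.
have -> : 'X - 1%:P = 1 *: \prod_(w <- [:: 1 : R[i]]) ('X - w%:P).
  by rewrite scale1r big_seq1.
by rewrite poly_mahlerE ?oner_eq0 // big_seq1 cabs1 ln1 logp1 addr0.
Qed.

(** * Northcott and Kronecker *)

(** Multiplication by ['X - z%:P] adds two shifted copies of the coefficients, each enlarged by at
    most the factor max(1, |z|), which is [expR (logp (cabs z))]. *)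
Lemma coef_prod_XsubC_bound (R : realType) (s : seq R[i]) (i : nat) :
  cabs (\prod_(z <- s) ('X - z%:P))`_i <=
  2 ^+ size s * expR (\sum_(z <- s) logp (cabs z)).
Proof.
elim: s i => [|z s IH] i.
  rewrite !big_nil expR0 mulr1 coef1; case: eqP => _ /=; first by rewrite cabs1.
  by rewrite cabs0.
rewrite !big_cons /= expRD exprS mulrBl coefB coefXM mul_polyC coefZ.
set B := 2 ^+ _ * expR (\sum_(w <- s) _) in IH *.
have B0 : 0 <= B by apply: mulr_ge0; rewrite ?exprn_ge0 ?expR_ge0.
have z_le : cabs z <= expR (logp (cabs z)) /\ 1 <= expR (logp (cabs z)).
  split; last by rewrite -expR0 ler_expR logp_ge0.
  have := cabs_ge0 z; rewrite le0r => /predU1P[->|z0]; first exact: expR_ge0.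
  by rewrite -{1}(lnK z0) ler_expR /logp le_max lexx.
have -> : 2 * 2 ^+ size s * (expR (logp (cabs z)) * expR (\sum_(w <- s) logp (cabs w)))
   = expR (logp (cabs z)) * B + expR (logp (cabs z)) * B by rewrite /B; ring.
apply: le_trans (cabsD _ _) _; apply: lerD.
  case: eqP => _; first by rewrite cabs0 mulr_ge0 // expR_ge0.
  by apply: le_trans (IH _) _; rewrite ler_peMl //; case: z_le.
rewrite -mulN1r cabsM; have -> : cabs (-1 : R[i]) = 1.
  by have := cabs_int R (-1); rewrite rmorphN1 normrN1.
rewrite mul1r cabsM ler_pM ?cabs_ge0 //; by case: z_le.
Qed.

Lemma poly_mahler_coef_bound (R : realType) (f : {poly R[i]}) (i : nat) :
  f != 0 -> cabs f`_i <= 2 ^+ (size f).-1 * expR (poly_mahler f).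
Proof.
rewrite -lead_coef_eq0 => nzc; have [s Df] := poly_mahler_roots f.
set c := lead_coef f in nzc Df; rewrite Df poly_mahlerE // expRD lnK ?posrE ?cabs_gt0 //.
rewrite coefZ cabsM mulrCA ler_wpM2l ?cabs_ge0 // size_scale // size_prod_XsubC /=.
exact: coef_prod_XsubC_bound.
Qed.

Lemma poly_mahler_comp_opp (R : realType) (f : {poly R[i]}) : f != 0 ->
  poly_mahler (f \Po - 'X) = poly_mahler f.
Proof.
rewrite -lead_coef_eq0 => nzf; set c := lead_coef f in nzf *.
have [s ->] := poly_mahler_roots f; rewrite -/c poly_mahlerE // comp_polyZ rmorph_prod /=.
have -> : \prod_(z <- s) (('X - z%:P) \Po - 'X) =
    (-1) ^+ size s *: \prod_(z <- map -%R s) ('X - z%:P) :> {poly R[i]}.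
  elim: s => [|z s IH]; first by rewrite !big_nil scale1r.
  rewrite /= !big_cons IH comp_polyB comp_polyX comp_polyC exprS polyCN opprK.
  by rewrite -scalerA scaleN1r -scalerAr -scalerN -mulNr opprD.
have cabsN (w : R[i]) : cabs (- w) = cabs w by rewrite /cabs normrN.
have cabs_sign : cabs ((-1) ^+ size s : R[i]) = 1 by rewrite cabsX cabsN cabs1 expr1n.
rewrite scalerA poly_mahlerE ?mulf_neq0 ?signr_eq0 // cabsM cabs_sign mulr1 big_map.
by under eq_bigr do rewrite cabsN.
Qed.

(* Graeffe's method: [p(X) p(-X)] is a polynomial in [X^2]. *)
Lemma graeffe (R : realType) (p : {poly int}) (z : R[i]) :
  p != 0 -> root (ZtoC R p) z ->
  exists q : {poly int}, [/\ q != 0, size q = size p, root (ZtoC R q) (z ^+ 2) &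
    poly_mahler (ZtoC R q) = poly_mahler (ZtoC R p) *+ 2].
Proof.
move=> nzp p_z; pose p' := p \Po - 'X; pose h := p * p'.
have p'K : p' \Po - 'X = p.
  by rewrite /p' -comp_polyA raddfN /= comp_polyX opprK comp_polyXr.
have size_p' : size p' = size p.
  rewrite /p' size_comp_poly2 // size_polyN size_polyX //.
have nzp' : p' != 0 by rewrite -size_poly_eq0 size_p' size_poly_eq0.
have h_even : h \Po - 'X = h by rewrite /h comp_polyM p'K mulrC.
pose q := even_poly h.
have X2N : 'X^2 \Po - 'X = 'X^2 :> {poly int} by rewrite comp_Xn_poly sqrrN.
(* Composition with [- 'X] changes the sign of the odd part only, so the evenness of [h] kills
   it. *)
have q_h : q \Po 'X^2 = h.
  have := poly_even_odd h; rewrite -/q; set o := odd_poly h \Po 'X^2 => Dh.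
  have : h \Po - 'X = q \Po 'X^2 - o * 'X.
    rewrite -[in LHS]Dh comp_polyD comp_polyM comp_polyX -!comp_polyA X2N.
    by rewrite mulrN.
  rewrite h_even -{1}Dh => /addrI/eqP; rewrite -addr_eq0 -mulr2n -scaler_nat -mul_polyC.
  rewrite mulf_eq0 polyC_eq0 /= => /eqP oX.
  by rewrite -Dh oX addr0.
have nzh : h != 0 by rewrite mulf_neq0.
have nzq : q != 0 by apply: contraNneq nzh => q0; rewrite -q_h q0 comp_poly0.
exists q; split=> //.
- have := size_comp_poly q 'X^2; rewrite q_h size_polyXn /h size_mul // size_p'.
  have := size_poly_gt0 p; have := size_poly_gt0 q; rewrite nzp nzq.
  by move: (size p) (size q) => m n; lia.
- have -> : root (ZtoC R q) (z ^+ 2) = root (ZtoC R q \Po 'X^2) z.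
    by rewrite !rootE horner_comp hornerXn.
  by rewrite -(map_polyXn (intr : int -> R[i])) -map_comp_poly q_h rmorphM rootM p_z.
rewrite -(@poly_mahler_comp_Xn _ _ 2) ?ZtoC_eq0 //.
rewrite -(map_polyXn (intr : int -> R[i])) -map_comp_poly q_h rmorphM /=.
rewrite poly_mahlerM ?ZtoC_eq0 // /p' map_comp_poly raddfN /= map_polyX.
by rewrite poly_mahler_comp_opp ?ZtoC_eq0.
Qed.

(** The size stays fixed while the measure doubles at each squaring, so a single degree bound covers
    all these powers of [z]. *)
Lemma graeffe_iter (R : realType) (p : {poly int}) (z : R[i]) k :
  p != 0 -> root (ZtoC R p) z ->
  exists q : {poly int}, [/\ q != 0, size q = size p, root (ZtoC R q) (z ^+ (2 ^ k)%N) &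
    poly_mahler (ZtoC R q) = poly_mahler (ZtoC R p) * 2 ^+ k].
Proof.
move=> nzp p_z; elim: k => [|k [q [nzq size_q q_z Mq]]].
  by exists p; rewrite mulr1 expn0 expr1.
have [u [nzu size_u u_z Mu]] := graeffe nzq q_z; exists u; split=> //.
- by rewrite size_u.
- by rewrite expnSr exprM.
- by rewrite Mu Mq exprSr mulrA mulr_natr.
Qed.

(** Bounded size and measure bound the coefficients, which leaves finitely many integer polynomials;
    [s] collects all their roots. *)
Lemma northcott (R : realType) (D : nat) :
  exists s : seq R[i], forall (p : {poly int}) (z : R[i]),
    p != 0 -> (size p <= D.+1)%N -> root (ZtoC R p) z ->
    poly_mahler (ZtoC R p) <= 1 -> z \in s.
Proof.
pose B := (Num.trunc (2 ^+ D * expR 1 : R)).+1.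
(* The coefficients range from [- B] to [B] and are stored in the finite type shifted by [B]. *)
pose poly_of (f : {ffun 'I_D.+1 -> 'I_(B + B).+1}) : {poly int} :=
  \poly_(i < D.+1) ((f (inord i) : nat)%:Z - B%:Z).
exists (flatten [seq complex_roots (ZtoC R (poly_of f)) |
  f <- enum {ffun 'I_D.+1 -> 'I_(B + B).+1}]).
move=> p z nzp size_p p_z Mp.
have coef_p i : `|p`_i| <= B%:Z.
  have := poly_mahler_coef_bound i (_ : ZtoC R p != 0); rewrite ZtoC_eq0 => /(_ nzp).
  rewrite coef_map cabs_int /= size_ZtoC => le1.
  have le2 : (`|p`_i|%:~R : R) <= 2 ^+ D * expR 1.
    apply: le_trans le1 _; apply: ler_pM; rewrite ?exprn_ge0 ?expR_ge0 ?ler_expR //.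
    by rewrite ler_weXn2l ?ler1n // -ltnS; case: (size p) size_p.
  rewrite -(ler_int R); apply: le_trans le2 _; apply: ltW; exact: truncnS_gt.
pose f : {ffun 'I_D.+1 -> 'I_(B + B).+1} := [ffun i : 'I_D.+1 => inord (absz (p`_i + B%:Z)%R)].
have Dp : poly_of f = p.
  apply/polyP => i; rewrite coef_poly; case: ltnP => [lt_i|le_i]; last first.
    by rewrite nth_default // (leq_trans size_p).
  rewrite ffunE !inordK //; have := coef_p i; lia.
apply/flattenP; exists (complex_roots (ZtoC R (poly_of f))).
  by apply/mapP; exists f; rewrite ?mem_enum.
rewrite Dp /complex_roots; case: closed_field_poly_normal => r /= Dr.
by move: p_z; rewrite Dr rootZ ?root_prod_XsubC // lead_coef_eq0 ZtoC_eq0.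
Qed.

(* If [M(p)] is tiny, many of the iterates [z^(2^k)] have Mahler measure at
   most 1, so two of them coincide. *)
Lemma kronecker_uniform (R : realType) (D : nat) :
  exists2 c : R, 0 < c & forall (p : {poly int}) (z : R[i]),
    p != 0 -> (size p <= D.+1)%N -> root (ZtoC R p) z -> z != 0 ->
    poly_mahler (ZtoC R p) < c -> exists2 n, (0 < n)%N & z ^+ n = 1.
Proof.
have [s s_roots] := northcott R D; set T := size s.
(* With this threshold, [2 ^+ k] times the measure is at most 1 for every [k <= T]. The [T.+1]
   corresponding powers all lie in [s], so they cannot be distinct. *)
exists (2 ^- T); first by rewrite invr_gt0 exprn_gt0.
move=> p z nzp size_p p_z nz_z Mp.
pose t := [seq z ^+ (2 ^ k)%N | k <- iota 0 T.+1].
have t_s : {subset t <= s}.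
  move=> w /mapP[k]; rewrite mem_iota add0n ltnS => le_kT ->{w}.
  have [q [nzq size_q q_z Mq]] := graeffe_iter k nzp p_z.
  apply: (s_roots q) => //; first by rewrite size_q.
  rewrite Mq; apply: (@le_trans _ _ (poly_mahler (ZtoC R p) * 2 ^+ T)).
    by rewrite ler_wpM2l ?poly_mahler_int_ge0 // ler_weXn2l // ler1n.
  by rewrite -ler_pdivlMr ?exprn_gt0 // div1r ltW.
apply: contrapT => no_n; suff uniq_t : uniq t.
  by have := uniq_leq_size uniq_t t_s; rewrite size_map size_iota ltnn.
rewrite map_inj_uniq ?iota_uniq // => i j eq_ij.
wlog lt_ij : i j eq_ij / (i < j)%N.
  by move=> W; case: (ltngtP i j) => // ?; [exact: W | apply/esym; exact: W].
case: no_n; exists (2 ^ j - 2 ^ i)%N; first by rewrite subn_gt0 ltn_exp2l.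
apply: (mulfI (expf_neq0 (2 ^ i)%N nz_z)).
by rewrite -exprD subnKC ?mulr1 // leq_exp2l // ltnW.
Qed.

(** * Replacing the factors of a factorization *)

Lemma int_coefs_poly (L : fieldType) (P : {poly L}) :
  (forall i, exists n : int, P`_i = n%:~R) ->
  exists F : {poly int}, P = map_poly intr F.
Proof.
move=> /choice[F0 PF]; exists (\poly_(i < size P) F0 i); apply/polyP => i.
rewrite coef_map coef_poly; case: ltnP => [_|le_i]; first exact: PF.
by rewrite nth_default.
Qed.

Lemma ZtoC_morph (R : realType) (L : fieldType) (f : {rmorphism L -> R[i]}) (p : {poly int}) :
  map_poly f (map_poly intr p) = ZtoC R p.
Proof. by rewrite -map_poly_comp; apply: eq_map_poly => a /=; rewrite rmorph_int. Qed.

(** The two polynomials divide each other over [L]: [minPoly] divides every rational annihilator,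
    and clearing its denominators gives an integer polynomial that [min_poly] divides. *)
Lemma min_poly_minPoly (R : realType) (L : fieldExtType rat)
    (f : {rmorphism L -> R[i]}) (x : L) :
  algebraicOver (ratr : rat -> R[i]) (f x) ->
  map_poly intr (min_poly (f x)) = (lead_coef (min_poly (f x)))%:~R *: minPoly 1 x.
Proof.
move=> alg_x; set p := min_poly (f x); have [_ _ p_x] := min_polyP alg_x.
have over1 (q : {poly int}) : map_poly intr q \is a polyOver (1%AS : {subfield L}).
  by apply/polyOverP => i; rewrite coef_map /= rpred_int.
have dvd1 : minPoly 1 x %| map_poly intr p.
  apply: minPoly_dvdp; first exact: over1.
  by rewrite -(fmorph_root f) ZtoC_morph.
have dvd2 : (map_poly intr p : {poly L}) %| minPoly 1 x.
  have /polyOver1P[q Dq] := minPolyOver 1 x.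
  have [u [a nza Du]] := rat_poly_scale q.
  have Dm : minPoly 1 x = (a%:~R^-1 : L) *: map_poly intr u.
    rewrite Dq Du map_polyZ -map_poly_comp (fmorphV (in_alg L)) /= scaler_int.
    by congr (_ *: _); apply: eq_map_poly => n /=; rewrite scaler_int.
  have nza' : (a%:~R^-1 : L) != 0.
    by rewrite invr_eq0 -scaler_int scaler_eq0 intr_eq0 (negPf nza) oner_eq0.
  have : root (map_poly f (minPoly 1 x)) (f x) by rewrite fmorph_root root_minPoly.
  rewrite Dm map_polyZ rootZ ?fmorph_eq0 // ZtoC_morph => /(min_poly_dvd alg_x)[v ->].
  by rewrite dvdpZr // rmorphM dvdp_mulIl.
have eqp_xp : minPoly 1 x %= map_poly intr p by rewrite /eqp dvd1 dvd2.
have := eqp_eq eqp_xp; rewrite (monicP (monic_minPoly 1 x)) scale1r => <-.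
congr (_ *: _); apply: (fmorph_inj f).
by rewrite -lead_coef_map ZtoC_morph lead_coef_ZtoC rmorph_int.
Qed.

Lemma minPoly_size_dim (L : fieldExtType rat) (K : {subfield L}) (b : L) :
  b \in K -> (size (minPoly 1 b) <= (\dim K).+1)%N.
Proof.
move=> bK; rewrite size_minPoly ltnS.
have := dim_Fadjoin 1 b; rewrite dimv1 muln1 => <-.
by apply: dimvS; apply/FadjoinP; rewrite sub1v.
Qed.

Lemma dim_Fadjoin_seq_le (L : fieldExtType rat) (d : nat) (s : seq L) :
  {in s, forall z, (size (minPoly 1 z) <= d.+1)%N} ->
  (\dim <<1 & s>> <= d ^ size s)%N.
Proof.
elim/last_ind: s => [|s z IH] deg_s; first by rewrite Fadjoin_nil dimv1.
rewrite adjoin_rcons size_rcons expnS dim_Fadjoin; apply: leq_mul.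
  rewrite -ltnS -size_minPoly; apply: leq_trans (deg_s z _); last by rewrite mem_rcons mem_head.
  apply: dvdp_leq; first by rewrite monic_neq0 // monic_minPoly.
  by apply: minPolyS; exact: sub1v.
by apply: IH => y ys; apply: deg_s; rewrite mem_rcons in_cons ys orbT.
Qed.

(** There are [d] conjugates, each of degree at most [d]. The resulting bound depends on [f x] only
    and not on [L], which will vary with the factorization. *)
Lemma normal_closure (R : realType) (L : splittingFieldType rat)
    (f : {rmorphism L -> R[i]}) (x : L) (d := (size (min_poly (f x))).-1) :
  algebraicOver (ratr : rat -> R[i]) (f x) ->
  exists K : {subfield L}, [/\ normalField 1 K, x \in K & (\dim K <= d ^ d)%N].
Proof.
move=> alg_x; have := galois_factors (subvf _) (@galois_number_field L 1%AS).
move=> /(_ x (memvf x))[r [_ _ Dp]]; set rs := map _ r in Dp.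
have nza : ((lead_coef (min_poly (f x)))%:~R : L) != 0.
  by rewrite -(fmorph_eq0 f) rmorph_int intr_eq0 lead_coef_eq0 min_poly_neq0.
have size_x : size (minPoly 1 x) = d.+1.
  rewrite -(size_scale _ nza) -min_poly_minPoly // -(size_map_poly f) ZtoC_morph.
  by rewrite size_ZtoC /d prednK // lt0n size_poly_eq0 min_poly_neq0.
have size_rs : size rs = d.
  by apply/succn_inj; rewrite -size_x Dp size_prod_XsubC.
exists <<1 & rs>>%AS; split.
- apply/splitting_normalField; first exact: sub1v.
  exists (minPoly 1 x); first exact: minPolyOver.
  by exists rs => //; rewrite Dp eqpxx.
- by apply: seqv_sub_adjoin; rewrite -root_prod_XsubC -Dp root_minPoly.
rewrite -{2}size_rs; apply: dim_Fadjoin_seq_le => z z_rs.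
rewrite -size_x; apply: dvdp_leq; first by rewrite monic_neq0 // monic_minPoly.
by apply: minPoly_dvdp; rewrite ?minPolyOver // Dp root_prod_XsubC.
Qed.

Lemma subseq_flatten_mask (T : eqType) (m : bitseq) (B : seq (seq T)) :
  subseq (flatten (mask m B)) (flatten B).
Proof.
elim: B m => [|t B IH] [|[] m] //=; first exact: sub0seq.
  by apply: cat_subseq.
by apply: subseq_trans (IH m) (suffix_subseq _ _).
Qed.

(** A subproduct of the conjugates of [b] is a product of distinct conjugates of [x], so [c] times
    it is integral. Hence [c%:~R *: minPoly 1 b] has coefficients that are both integral and
    rational. *)
Lemma minPoly_block_int (L : splittingFieldType rat)
    (c : int) (x b : L) (rs : seq L) (B : seq (seq L)) (p : {poly int}) :
  map_poly intr p = c%:~R *: minPoly 1 x ->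
  minPoly 1 x = \prod_(z <- rs) ('X - z%:P) -> uniq rs ->
  minPoly 1 b = \prod_(u <- [seq \prod_(w <- s) w | s <- B]) ('X - u%:P) ->
  uniq (flatten B) -> {subset flatten B <= rs} ->
  exists F : {poly int}, map_poly intr F = c%:~R *: minPoly 1 b.
Proof.
move=> Dp Dx uniq_rs Db uniq_B B_rs.
have int_b i : Zintegral (c%:~R *: minPoly 1 b)`_i.
  rewrite Db; apply: Zintegral_coef_prod_masks => m {i}.
  have -> : \prod_(u <- mask m [seq \prod_(w <- s) w | s <- B]) u =
            \prod_(w <- flatten (mask m B)) w.
    rewrite -map_mask big_map big_flatten; elim: (mask m B) => [|t C IH].
      by rewrite !big_nil.
    by rewrite /= !big_cons IH.
  apply: (Zintegral_lead_prod_roots (rs := rs)) => //.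
  - by move=> i; rewrite -Dx -Dp coef_map; exact: integral_id.
  - by apply: subseq_uniq uniq_B; exact: subseq_flatten_mask.
  - move=> w w_m; apply: B_rs; apply: mem_subseq w_m.
    exact: subseq_flatten_mask.
have [F DF] : exists F : {poly int}, c%:~R *: minPoly 1 b = map_poly intr F.
  apply: int_coefs_poly => i; move: (int_b i).
  have /polyOver1P[q ->] := minPolyOver 1 b.
  rewrite coefZ coef_map -scaler_int -(rmorphM (in_alg L)).
  move=> /(Zintegral_rat (f := in_alg L))[n ->].
  by exists n; rewrite /= scaler_int.
by exists F.
Qed.

(** The third hypothesis is Kronecker's theorem with a threshold uniform in bounded degree; as a
    hypothesis it allows [c] to be fixed before [L] and [K]. The exponent in the last conclusion is
    the same for all [x], so that these identities can be multiplied together. *)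
Lemma replace_factor (R : realType) (L : splittingFieldType rat)
    (f : {rmorphism L -> R[i]}) (K : {subfield L}) (D : nat) (c : R) (x : L) :
  normalField 1 K -> (\dim K <= D)%N ->
  (forall (p : {poly int}) (z : R[i]), p != 0 -> (size p <= D.+1)%N ->
     root (ZtoC R p) z -> z != 0 -> poly_mahler (ZtoC R p) < c ->
     exists2 n, (0 < n)%N & z ^+ n = 1) ->
  algebraic_unit (f x) ->
  exists g : R[i], [/\ algebraic_unit g, mahler g <= mahler (f x),
    mahler (f x) < c -> mahler g = 0 &
    g ^+ #|'Gal({:L} / K)%g| = f (\prod_(h in 'Gal({:L} / K)%g) (h : gal_of {:L}) x)].
Proof.
move=> nK dimK kron [nz_fx alg_fx].
have nzx : x != 0 by rewrite -(fmorph_eq0 f).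
have [rs [uniq_rs Dx [b [r [t [B [bK rt bt Db [uniq_B B_rs]]]]]]]] := galois_block_factors x nK.
have Dp := min_poly_minPoly alg_fx.
set p := min_poly (f x) in Dp; set a := lead_coef p in Dp.
have nza : (a%:~R : R[i]) != 0 by rewrite intr_eq0 lead_coef_eq0 min_poly_neq0.
have [F DF] := minPoly_block_int Dp Dx uniq_rs Db uniq_B B_rs.
have rt_gt0 : (0 < r * t)%N by rewrite rt cardG_gt0.
have [r_gt0 t_gt0] : (0 < r)%N /\ (0 < t)%N by apply/andP; rewrite -muln_gt0.
have nzb : b != 0.
  have : b ^+ t != 0.
    rewrite bt; apply/prodf_neq0 => h _; by rewrite fmorph_eq0.
  by rewrite expf_eq0 t_gt0.
have DFC : ZtoC R F = a%:~R *:
    \prod_(u <- [seq f (\prod_(w <- s) w) | s <- B]) ('X - u%:P).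
  rewrite -(ZtoC_morph f) DF Db map_polyZ rmorph_int rmorph_prod !big_map /=.
  by under eq_bigr do rewrite map_polyXsubC.
have DpC : ZtoC R p = a%:~R *: \prod_(u <- [seq f w | w <- rs]) ('X - u%:P).
  rewrite -(ZtoC_morph f) Dp Dx map_polyZ rmorph_int rmorph_prod !big_map /=.
  by under eq_bigr do rewrite map_polyXsubC.
have nzF : F != 0.
  by rewrite -(ZtoC_eq0 R) DFC scaler_eq0 negb_or nza monic_neq0 // monic_prod_XsubC.
(* The leading coefficients agree. Each root of [F] is a product over a block, with [logp] at most
   the sum over that block, and the conjugates outside all blocks only add non-negative terms. *)
have MF : poly_mahler (ZtoC R F) <= mahler (f x).
  rewrite /mahler -/p DFC DpC !poly_mahlerE // lerD2l !big_map.
  apply: (@le_trans _ _ (\sum_(w <- flatten B) logp (cabs (f w)))).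
    rewrite big_flatten /=; apply: ler_sum => s _.
    rewrite rmorph_prod -(big_map f xpredT id).
    by rewrite -(big_map f xpredT (fun w => logp (cabs w))) logp_prod.
  rewrite (perm_big _ (perm_complement uniq_rs uniq_B B_rs)) big_cat /= lerDr.
  by apply: sumr_ge0 => w _; exact: logp_ge0.
have F_b : root (ZtoC R F) (f b).
  by rewrite -(ZtoC_morph f) DF fmorph_root rootZ ?root_minPoly // -(fmorph_eq0 f) rmorph_int.
have size_F : (size F <= D.+1)%N.
  have nza' : (a%:~R : L) != 0 by rewrite -(fmorph_eq0 f) rmorph_int.
  rewrite -(size_ZtoC R) -(ZtoC_morph f) size_map_poly DF size_scale //.
  by apply: leq_trans (minPoly_size_dim bK) _; rewrite ltnS.
(* Any [r]-th root serves: it is a root of [F \Po 'X^r], whose measure is that of [F], and its power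
   of exponent [r * t] is the norm of [x]. *)
have [g g_r] : exists g : R[i], g ^+ r = f b.
  by exists (r.-root (f b)); rewrite rootCK.
have gm : g ^+ #|'Gal({:L} / K)%g| = f (b ^+ t) by rewrite -rt exprM g_r rmorphXn.
have nzg : g != 0.
  have : g ^+ r != 0 by rewrite g_r fmorph_eq0.
  by rewrite expf_eq0 r_gt0.
have Fr_g : root (ZtoC R (F \Po 'X^r)) g.
  by rewrite map_comp_poly map_polyXn rootE horner_comp hornerXn g_r.
have nzFr : F \Po 'X^r != 0.
  by rewrite -(ZtoC_eq0 R) map_comp_poly map_polyXn comp_poly_eq0 ?ZtoC_eq0 // size_polyXn.
have alg_g := algebraic_int_root nzFr Fr_g.
exists g; split; rewrite ?gm ?bt //.
  apply: le_trans (mahler_le alg_g nzFr Fr_g) _.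
  by rewrite map_comp_poly map_polyXn poly_mahler_comp_Xn ?ZtoC_eq0.
(* Below the threshold [f b] is a root of unity, and hence so is its [r]-th root [g]. *)
move=> lt_c; have [n n_gt0 bn] : exists2 n, (0 < n)%N & f b ^+ n = 1.
  apply: (kron F) => //; first by rewrite fmorph_eq0.
  exact: le_lt_trans MF lt_c.
by apply: (@mahler_unity_root _ _ (r * n)); rewrite ?muln_gt0 ?r_gt0 // exprM g_r.
Qed.

(** [c] depends on [alpha] alone. With [m] the order of the Galois group over [K], the [m]-th powers
    of the new factors are the norms of the old ones; these multiply to the norm of [alpha], which
    is [alpha ^+ m] because [alpha] comes from [K]. *)
Lemma factorization_reduction (R : realType) (alpha : R[i]) :
  algebraic_unit alpha ->
  exists2 c : R, 0 < c & forall (a : nat -> R[i]) (N : nat),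
    (forall i, algebraic_unit (a i)) -> \prod_(i < N) a i = alpha ->
    exists g : nat -> R[i],
      (forall i, (i < N)%N -> [/\ algebraic_unit (g i), mahler (g i) <= mahler (a i) &
         mahler (a i) < c -> mahler (g i) = 0]) /\
      exists2 m, (0 < m)%N & (\prod_(i < N) g i) ^+ m = alpha ^+ m.
Proof.
move=> [nz_alpha alg_alpha]; set d := (size (min_poly alpha)).-1.
have [c c_gt0 kron] := kronecker_uniform R (d ^ d); exists c => // a N alg_a prod_a.
(* All the minimal polynomials are multiplied together, so that a single splitting field contains
   [alpha] and every factor. *)
pose P := \prod_(i < N) map_poly (intr : int -> rat) (min_poly (a i)).
pose Q := map_poly (intr : int -> rat) (min_poly alpha) * P.
have nz_rat z : algebraicOver (ratr : rat -> R[i]) z ->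
    map_poly (intr : int -> rat) (min_poly z) != 0.
  move=> /min_poly_neq0; rewrite -!lead_coef_eq0 lead_coef_map_inj ?intr_eq0 //.
  exact: intr_inj.
have nzQ : Q != 0.
  rewrite mulf_neq0 ?nz_rat //; apply/prodf_neq0 => i _.
  by rewrite nz_rat //; case: (alg_a i).
have [L [f f_im]] := splitting_field_embedding R[i] nzQ.
have root_min z : algebraicOver (ratr : rat -> R[i]) z ->
    root (map_poly (ratr : rat -> R[i]) (map_poly intr (min_poly z))) z.
  by move=> /min_polyP[_ _]; rewrite ZtoC_ratr.
have [alpha' Dalpha] : exists y, f y = alpha.
  by apply: f_im; rewrite rmorphM rootM root_min.
(* Indices from [N] on get the dummy value 0, so that choice yields a total function; the same
   device is used for [step]. *)
have f_a i : exists y, (i < N)%N -> f y = a i.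
  case: (ltnP i N) => [lt_iN|]; last by exists 0.
  have [y Dy] : exists y, f y = a i; last by exists y.
  apply: f_im; rewrite /Q /P (bigD1 (Ordinal lt_iN)) //= !rmorphM !rootM root_min ?orbT //.
  by case: (alg_a i).
move: f_a => /choice[a' Da].
have [K [nK alphaK dimK]] : exists K : {subfield L},
    [/\ normalField 1 K, alpha' \in K & (\dim K <= d ^ d)%N].
  by move: (@normal_closure _ _ f alpha'); rewrite Dalpha; apply.
pose H := 'Gal({:L} / K)%G.
have step i : exists g, (i < N)%N -> [/\ algebraic_unit g, mahler g <= mahler (a i),
    mahler (a i) < c -> mahler g = 0 &
    g ^+ #|H| = f (\prod_(h in H) (h : gal_of {:L}) (a' i))].
  case: (ltnP i N) => [lt_iN|]; last by exists 0.
  have [|g] := @replace_factor _ _ f K (d ^ d) c (a' i) nK dimK kron.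
    by rewrite Da.
  by rewrite !Da // => ?; exists g.
move: step => /choice[g Dg]; exists g; split; first by move=> i /Dg[].
exists #|H|; first exact: cardG_gt0.
rewrite -prodrXl.
rewrite (eq_bigr (fun i : 'I_N => f (\prod_(h in H) (h : gal_of {:L}) (a' i)))); last first.
  by move=> i _; case: (Dg i (ltn_ord i)).
(* After the exchange, each [h] acts on the whole product [alpha'], which it fixes. *)
rewrite -rmorph_prod exchange_big /= -Dalpha -rmorphXn; congr (f _).
have Dprod : \prod_(i < N) a' i = alpha'.
  apply: (fmorph_inj f); rewrite Dalpha -prod_a rmorph_prod.
  by apply: eq_bigr => i _; rewrite Da.
rewrite -prodr_const; apply: eq_bigr => h hH; rewrite -rmorph_prod Dprod.
by apply: fixed_gal hH alphaK; exact: subvf.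
Qed.

(** * Comparison of l^x-norms *)

(** Weighted AM-GM for [t] and 1. With [w] the right-hand side, [ln u <= u - 1] is applied at
    [t / w] and [w^-1]; the bounds weighted by [p] and [1 - p] add up to 0. *)
Lemma powR_le_linear (R : realType) (t p : R) : 0 < t -> 0 < p <= 1 ->
  t `^ p <= p * t + (1 - p).
Proof.
move=> t0 /andP[p0 p1]; set w := p * t + (1 - p).
have w0 : 0 < w by apply: ltr_pwDl; rewrite ?mulr_gt0 ?subr_ge0.
have ln_le (u : R) : 0 < u -> ln u <= u - 1.
  by move=> u0; have := @le_ln1Dx R (u - 1); rewrite [1 + _]addrC subrK; apply; lra.
have h1 := ln_le (t / w) (divr_gt0 t0 w0).
have h2 : ln w^-1 <= w^-1 - 1 by apply: ln_le; rewrite invr_gt0.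
rewrite ln_div ?posrE // in h1; rewrite lnV ?posrE // in h2.
rewrite -ler_ln ?posrE ?powR_gt0 // ln_powR.
have nzw : w != 0 by rewrite gt_eqF.
have e : p * (t / w - 1) + (1 - p) * (w^-1 - 1) = 0.
  have -> : p * (t / w - 1) + (1 - p) * (w^-1 - 1) = (p * t + (1 - p)) / w - 1 by field.
  by rewrite -/w divff // subrr.
have q0 : 0 <= 1 - p by rewrite subr_ge0.
have := lerD (ler_wpM2l (ltW p0) h1) (ler_wpM2l q0 h2); rewrite e; lra.
Qed.

Lemma powR_mulr_pred (R : realType) (a r : R) : 0 < a -> a `^ r = a * a `^ (r - 1).
Proof.
move=> a0; rewrite -[X in X * _](powRr1 (ltW a0)) -powRD ?(gt_eqF a0) ?implybT //.
by rewrite [1 + _]addrC subrK.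
Qed.

(** With S the sum of the m_i^x, each m_i^x is at most S, so m_i^y = m_i^x (m_i^x)^(y/x - 1) is at
    most m_i^x S^(y/x - 1); these bounds add up to S^(y/x). *)
Lemma powR_sum_le (R : realType) (N : nat) (m : nat -> R) (x y : R) :
  (forall i, 0 <= m i) -> 0 < x -> x <= y ->
  (\sum_(i < N) m i `^ y) `^ y^-1 <= (\sum_(i < N) m i `^ x) `^ x^-1.
Proof.
move=> m0 x0 xy; have y0 : 0 < y by exact: lt_le_trans xy.
set S := \sum_(i < N) m i `^ x.
have S0 : 0 <= S by apply: sumr_ge0 => i _; exact: powR_ge0.
have le_S (i : 'I_N) : m i `^ x <= S.
  by rewrite /S (bigD1 i) //= lerDl sumr_ge0 // => j _; exact: powR_ge0.
have p1 : 1 <= y / x by rewrite ler_pdivlMr // mul1r.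
have -> : S `^ x^-1 = (S `^ (y / x)) `^ y^-1.
  by rewrite -powRrM mulrAC divff ?mul1r // gt_eqF.
apply: ge0_ler_powR; rewrite ?nnegrE ?powR_ge0 ?invr_ge0 ?(ltW y0) //.
  by apply: sumr_ge0 => i _; exact: powR_ge0.
have -> : S `^ (y / x) = \sum_(i < N) m i `^ x * S `^ (y / x - 1).
  rewrite -mulr_suml -/S; move: S0; rewrite le0r => /predU1P[->|S0].
    by rewrite mul0r powR0 // gt_eqF // divr_gt0.
  by rewrite -powR_mulr_pred.
apply: ler_sum => i _.
have [->|mi0] := eqVneq (m i) 0; first by rewrite !powR0 ?mul0r ?gt_eqF.
have mx0 : 0 < m i `^ x by rewrite powR_gt0 // lt_neqAle eq_sym mi0 m0.
have -> : m i `^ y = m i `^ x * (m i `^ x) `^ (y / x - 1).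
  by rewrite -powR_mulr_pred // -powRrM mulrCA divff ?mulr1 // gt_eqF.
rewrite ler_wpM2l ?powR_ge0 // ge0_ler_powR ?nnegrE ?powR_ge0 //.
by rewrite subr_ge0.
Qed.

(** Hölder's inequality against the indicator of the support. It results from adding up weighted
    AM-GM inequalities for the entries m_i^y M / T, normalized to have sum M. *)
Lemma powR_sum_support (R : realType) (N : nat) (m : nat -> R) (M x y : R) :
  (forall i, 0 <= m i) -> 0 < x -> x <= y ->
  \sum_(i < N) (m i != 0)%:R <= M ->
  (\sum_(i < N) m i `^ x) `^ x^-1 <=
  M `^ (x^-1 - y^-1) * (\sum_(i < N) m i `^ y) `^ y^-1.
Proof.
move=> m0 x0 xy suppM; have y0 : 0 < y by exact: lt_le_trans xy.
set T := \sum_(i < N) m i `^ y.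
have : 0 <= T by apply: sumr_ge0 => i _; exact: powR_ge0.
rewrite le0r => /predU1P[T0|T0].
  have m_eq0 (i : 'I_N) : m i = 0.
    have /eqP := T0; rewrite psumr_eq0 => [/allP/(_ i)|j _]; last exact: powR_ge0.
    by rewrite mem_index_enum powR_eq0 => /(_ isT)/andP[/eqP].
  rewrite [X in X `^ x^-1]big1 => [|i _]; last by rewrite m_eq0 powR0 // gt_eqF.
  by rewrite powR0 ?invr_eq0 ?gt_eqF // mulr_ge0 // powR_ge0.
have M0 : 0 < M.
  apply: lt_le_trans suppM; rewrite lt_def sumr_ge0 // andbT.
  apply: contraTneq T0 => /eqP; rewrite psumr_eq0 // => /allP all0.
  rewrite -leNgt /T big1 // => i _; have := all0 i; rewrite mem_index_enum.
  by rewrite pnatr_eq0 eqb0 negbK => /(_ isT)/eqP ->; rewrite powR0 // gt_eqF.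
set p := x / y.
have p01 : 0 < p <= 1 by rewrite divr_gt0 //= ler_pdivrMr // mul1r.
(* For a zero entry both sides vanish, thanks to the indicator; otherwise this is [powR_le_linear]
   at the normalized entry. *)
have key (i : 'I_N) : m i `^ x <= (T / M) `^ p *
    (p * (m i `^ y / T * M) + (1 - p) * (m i != 0)%:R).
  have [->|mi0] := eqVneq (m i) 0.
    by rewrite !powR0 ?gt_eqF // !(mul0r, mulr0) addr0 mulr0.
  have mi : 0 < m i by rewrite lt_neqAle eq_sym mi0 m0.
  have v0 : 0 < m i `^ y by rewrite powR_gt0.
  have t0 : 0 < m i `^ y / T * M by rewrite mulr_gt0 ?divr_gt0.
  have -> : m i `^ x = (T / M) `^ p * (m i `^ y / T * M) `^ p.
    rewrite -powRM ?ltW ?divr_gt0 //.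
    have -> : T / M * (m i `^ y / T * M) = m i `^ y by field; rewrite ?gt_eqF.
    by rewrite -powRrM /p mulrCA divff ?mulr1 // gt_eqF.
  by rewrite mulr1 ler_wpM2l ?powR_ge0 //; exact: powR_le_linear.
have sum_le : \sum_(i < N) m i `^ x <= (T / M) `^ p * M.
  apply: le_trans (ler_sum _ (fun i _ => key i)) _.
  rewrite -mulr_sumr ler_wpM2l ?powR_ge0 // big_split /= -!mulr_sumr -!mulr_suml -/T.
  rewrite divff ?gt_eqF // mul1r.
  have /andP[_ p1] := p01; have q0 : 0 <= 1 - p by rewrite subr_ge0.
  by have := ler_wpM2l q0 suppM; lra.
have -> : M `^ (x^-1 - y^-1) * T `^ y^-1 = ((T / M) `^ p * M) `^ x^-1.
  rewrite [(_ * M) `^ _]powRM ?powR_ge0 ?(ltW M0) // -powRrM /p mulrAC divff ?gt_eqF // mul1r.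
  rewrite powRM ?(ltW T0) ?invr_ge0 ?(ltW M0) // -(powR_inv1 (ltW M0)) -powRrM mulN1r.
  by rewrite powRD ?(gt_eqF M0) ?implybT // mulrC mulrA mulrAC.
apply: ge0_ler_powR; rewrite ?nnegrE ?invr_ge0 ?mulr_ge0 ?powR_ge0 ?(ltW x0) ?(ltW M0) //.
by apply: sumr_ge0 => i _; exact: powR_ge0.
Qed.

(** * Continuity *)

Lemma fsbig_nat_ord (T : Type) (idx : T) (op : Monoid.com_law idx) (N : nat)
    (F : nat -> T) :
  (forall i, (N <= i)%N -> F i = idx) ->
  \big[op/idx]_(n \in [set: nat]) F n = \big[op/idx]_(i < N) F i.
Proof.
move=> F_idx; rewrite fsbig_ord; apply/esym/fsbig_widen => // i [_ /negP].
by rewrite /= -leqNgt => /F_idx.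
Qed.

Lemma finite_set_nat_bound (A : set nat) :
  finite_set A -> exists N, forall i, (N <= i)%N -> ~ A i.
Proof.
case/finite_seqP => s ->; exists (\max_(i <- s) i).+1 => i le_i /= si.
have : (i <= \max_(i <- s) i)%N by exact: (@leq_bigmax_seq _ _ xpredT id).
by rewrite leqNgt le_i.
Qed.

Lemma factorization_ord (R : realType) (alpha : R[i]) (a : nat -> R[i]) :
  factorization alpha a -> exists N, (forall i, (N <= i)%N -> a i = 1) /\
    \prod_(i < N) a i = alpha.
Proof.
move=> [_ /finite_set_nat_bound[N a1] prod_a]; exists N.
have a_eq1 i : (N <= i)%N -> a i = 1.
  by move=> /a1 /= /negP; rewrite negbK => /eqP.
by split=> //; rewrite -(fsbig_nat_ord *%R).
Qed.

Lemma ord_factorization (R : realType) (alpha : R[i]) (a : nat -> R[i]) N :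
  (forall i, algebraic_unit (a i)) -> (forall i, (N <= i)%N -> a i = 1) ->
  \prod_(i < N) a i = alpha -> factorization alpha a.
Proof.
move=> alg_a a1 prod_a; split=> //; last by rewrite (fsbig_nat_ord *%R (N := N)).
apply: (sub_finite_set _ (finite_II N)) => i /= ai; rewrite ltnNge.
by apply: contra ai => /a1 ->.
Qed.

Lemma mahler1 (R : realType) : mahler (1 : R[i]) = 0.
Proof. by apply: (@mahler_unity_root _ _ 1%N). Qed.

Lemma factorization_norm_ord (R : realType) (a : nat -> R[i]) N (x : R) :
  (forall i, (N <= i)%N -> a i = 1) -> 0 < x ->
  \sum_(n \in [set: nat]) mahler (a n) `^ x = \sum_(i < N) mahler (a i) `^ x.
Proof.
move=> a1 x0; apply: (fsbig_nat_ord +%R) => i /a1 ->.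
by rewrite mahler1 powR0 // gt_eqF.
Qed.

Lemma metric_mahler_le (R : realType) (alpha : R[i]) (a : nat -> R[i]) (x : R) :
  factorization alpha a ->
  metric_mahler x alpha <= (\sum_(n \in [set: nat]) mahler (a n) `^ x) `^ x^-1.
Proof.
move=> fa; apply: ge_inf; last by exists a.
by exists 0 => _ [b _ <-]; exact: powR_ge0.
Qed.

(** Makes the set under the infimum non-empty, as [lb_le_inf] demands, and bounds the infimum by
    [mahler alpha]. *)
Lemma trivial_factorization (R : realType) (alpha : R[i]) :
  algebraic_unit alpha ->
  factorization alpha (fun n => if n == 0%N then alpha else 1).
Proof.
move=> alg_alpha; apply: (@ord_factorization _ _ _ 1).
- by move=> [|i] //=; apply: (@algebraic_unity_root _ _ 1%N).
- by case.
- by rewrite big_ord1.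
Qed.

Lemma metric_mahler_ge (R : realType) (alpha : R[i]) (x t : R) :
  algebraic_unit alpha ->
  (forall a, factorization alpha a ->
    t <= (\sum_(n \in [set: nat]) mahler (a n) `^ x) `^ x^-1) ->
  t <= metric_mahler x alpha.
Proof.
move=> alg_alpha le_t; apply: lb_le_inf; last by move=> _ [a fa <-]; exact: le_t.
exists ((\sum_(n \in [set: nat]) mahler (if n == 0%N then alpha else 1) `^ x) `^ x^-1).
by exists (fun n => if n == 0%N then alpha else 1) => //; exact: trivial_factorization.
Qed.

Lemma metric_mahler_ge0 (R : realType) (alpha : R[i]) (x : R) :
  algebraic_unit alpha -> 0 <= metric_mahler x alpha.
Proof. by move=> alg_alpha; apply: metric_mahler_ge => // a _; exact: powR_ge0. Qed.

Lemma metric_mahler_le_mahler (R : realType) (alpha : R[i]) (x : R) :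
  algebraic_unit alpha -> 0 < x -> metric_mahler x alpha <= mahler alpha.
Proof.
move=> alg_alpha x0; apply: le_trans (metric_mahler_le x (trivial_factorization alg_alpha)) _.
rewrite (@factorization_norm_ord _ _ 1) //; last by case.
rewrite big_ord1 /= -powRrM divff ?gt_eqF // powRr1 //.
by case: alg_alpha => _; exact: mahler_ge0.
Qed.

Lemma metric_mahler_anti (R : realType) (alpha : R[i]) (x y : R) :
  algebraic_unit alpha -> 0 < x -> x <= y ->
  metric_mahler y alpha <= metric_mahler x alpha.
Proof.
move=> alg_alpha x0 xy; apply: metric_mahler_ge => // a fa.
apply: le_trans (metric_mahler_le y fa) _.
have [N [a1 _]] := factorization_ord fa; have y0 := lt_le_trans x0 xy.
rewrite !(factorization_norm_ord a1) //; apply: (@powR_sum_le _ _ (fun i => mahler (a i))) => // i.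
by apply: mahler_ge0; case: fa => /(_ i)[].
Qed.

(** [M] is uniform over the exponents up to [q], and the factor tends to 1 when [x] and [y] approach
    a common positive value. This is the converse estimate to monotonicity. *)
Lemma metric_mahler_comparison (R : realType) (alpha : R[i]) (q : R) :
  algebraic_unit alpha ->
  exists2 M : R, 1 <= M & forall x y, 0 < x -> x <= y -> y <= q ->
    metric_mahler x alpha <= M `^ (x^-1 - y^-1) * metric_mahler y alpha.
Proof.
move=> alg_alpha; have [c c0 red] := factorization_reduction alg_alpha.
set B := mahler alpha; pose C := Num.max 1 (B / c).
have C1 : 1 <= C by rewrite le_max lexx.
(* In a factorization of norm at most [B], at most (B/c)^y factors have measure at least [c]. The
   first summand dominates this for all [y <= q], and the second ensures [1 <= M]. *)
exists (C `^ Num.max 0 q + 1); first by rewrite lerDr powR_ge0.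
set M := _ + 1; have M1 : 1 <= M by rewrite lerDr powR_ge0.
move=> x y x0 xy yq; have y0 := lt_le_trans x0 xy.
have M0 : 0 < M := lt_le_trans ltr01 M1.
have e0 : 0 <= x^-1 - y^-1 by rewrite subr_ge0 lef_pV2 ?posrE.
have Me1 : 1 <= M `^ (x^-1 - y^-1) by rewrite -(powRr0 M) ler_powR.
have Me0 := lt_le_trans ltr01 Me1.
rewrite mulrC -ler_pdivrMr //; apply: metric_mahler_ge => // a fa.
have [N [a1 prod_a]] := factorization_ord fa.
have alg_a i : algebraic_unit (a i) by case: fa.
have ma_ge0 i : 0 <= mahler (a i) by case: (alg_a i) => _; exact: mahler_ge0.
rewrite (factorization_norm_ord a1) //; set S := \sum_(i < N) _.
have S0 : 0 <= S by apply: sumr_ge0 => i _; exact: powR_ge0.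
(* A factorization of norm above [B] is already beaten by the trivial one, so factors are replaced
   only when the norm is at most [B]. *)
case: (leP (S `^ y^-1) B) => [le_B|lt_B]; last first.
  apply: le_trans (ltW lt_B); apply: le_trans (metric_mahler_le_mahler alg_alpha x0).
  by rewrite ler_pdivrMr // ler_peMr // metric_mahler_ge0.
have [g [g_props [m m0 gm]]] := red a N alg_a prod_a.
set G := \prod_(i < N) g i in gm.
have nzG : G != 0 by apply/prodf_neq0 => i _; case: (g_props i (ltn_ord i)) => -[].
have zeta1 : (alpha / G) ^+ m = 1.
  by rewrite exprMn exprVn gm divff // expf_neq0 //; case: alg_alpha.
(* Slot [N] receives the root of unity [alpha / G], which corrects the product and has measure 0. *)
pose b n := if (n < N)%N then g n else if n == N then alpha / G else 1.
have b1 i : (N.+1 <= i)%N -> b i = 1.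
  by move=> lt_Ni; rewrite /b ltnNge (ltnW lt_Ni) /= gtn_eqF.
have alg_b i : algebraic_unit (b i).
  rewrite /b; case: ltnP => [/g_props[]//|_]; case: eqP => _.
    exact: algebraic_unity_root m0 zeta1.
  by apply: (@algebraic_unity_root _ _ 1%N).
have bN : b N = alpha / G by rewrite /b ltnn eqxx.
have bE (i : 'I_N) : b i = g i by rewrite /b ltn_ord.
have fb : factorization alpha b.
  apply: (@ord_factorization _ _ _ N.+1) => //.
  by rewrite big_ord_recr /= (eq_bigr _ (fun i _ => bE i)) bN mulrC divfK.
have mb_ge0 i : 0 <= mahler (b i) by case: (alg_b i) => _; exact: mahler_ge0.
have mbN : mahler (b N) = 0 by rewrite bN (mahler_unity_root m0).
rewrite ler_pdivrMr // mulrC; apply: le_trans (metric_mahler_le x fb) _.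
rewrite (factorization_norm_ord b1) //.
have count_b : \sum_(i < N.+1) (mahler (b i) != 0)%:R <= M.
  rewrite big_ord_recr /= mbN eqxx addr0 /M.
  apply: ler_wpDr => //; set k := \sum_(i < N) _.
  (* An index counted by [k] has [mahler (a i)] at least [c], so it contributes at least c^y to
     [S]. *)
  have k_le : k * c `^ y <= S.
    rewrite mulr_suml; apply: ler_sum => i _; rewrite bE.
    have [_ _ small] := g_props i (ltn_ord i).
    case: (ltP (mahler (a i)) c) => [/small ->|le_c]; first by rewrite eqxx mul0r powR_ge0.
    case: eqP => _; first by rewrite mul0r powR_ge0.
    by rewrite mul1r ge0_ler_powR ?nnegrE ?(ltW y0) ?(ltW c0).
  have S_le : S <= B `^ y.
    have -> : S = (S `^ y^-1) `^ y by rewrite -powRrM mulVf ?powRr1 // gt_eqF.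
    by rewrite ge0_ler_powR ?nnegrE ?powR_ge0 ?(ltW y0) // (le_trans _ le_B) ?powR_ge0.
  have B0 : 0 <= B by rewrite (le_trans _ le_B) ?powR_ge0.
  have : k <= (B / c) `^ y.
    rewrite powRM ?invr_ge0 ?(ltW c0) // -(powR_inv1 (ltW c0)) -powRrM mulN1r powRN.
    by rewrite ler_pdivlMr ?powR_gt0 // (le_trans k_le).
  move=> /le_trans; apply; apply: (@le_trans _ _ (C `^ y)).
    rewrite ge0_ler_powR ?nnegrE ?divr_ge0 ?(ltW y0) ?(ltW c0) ?(le_trans ler01 C1) //.
    by rewrite le_max lexx orbT.
  by rewrite ler_powR // le_max yq orbT.
(* The two norms of [b] are compared first; its norm of exponent [y] is then at most that of [a],
   since no replacement increases a measure. *)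
apply: le_trans (powR_sum_support (m := fun i => mahler (b i)) mb_ge0 x0 xy count_b) _.
rewrite ler_wpM2l ?powR_ge0 // ge0_ler_powR ?nnegrE ?invr_ge0 ?(ltW y0) //.
  by apply: sumr_ge0 => i _; exact: powR_ge0.
rewrite big_ord_recr /= mbN powR0 ?gt_eqF // addr0; apply: ler_sum => i _.
rewrite ge0_ler_powR ?nnegrE ?(ltW y0) // bE.
by case: (g_props i (ltn_ord i)).
Qed.

Theorem theorem1p5 (R : realType) (alpha : R[i])
    (halpha : algebraic_unit alpha) :
  {within [set x : R | 0 < x], continuous (fun x : R => metric_mahler x alpha)}.
Proof.
rewrite continuous_open_subspace; last exact: open_gt.
move=> x0; rewrite inE /= => x0_gt0.
(* The cap [x0 + 1] lets one constant [M] serve a whole neighbourhood of [x0]. *)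
have [M M1 cmp] := metric_mahler_comparison (x0 + 1) halpha.
set f := fun x : R => metric_mahler x alpha.
have f0 x : 0 <= f x by exact: metric_mahler_ge0.
have M0 : 0 < M := lt_le_trans ltr01 M1.
pose e (x : R) := `|x^-1 - x0^-1| * ln M.
(* Valid in either order: for [x <= y] it is the comparison, and for [y <= x] monotonicity suffices.
   Exchanging [x] and [y] later gives the lower bound. *)
have cmp_e x y : 0 < x -> 0 < y -> x <= x0 + 1 -> y <= x0 + 1 ->
    f x <= expR (`|x^-1 - y^-1| * ln M) * f y.
  move=> x_gt0 y_gt0 xq yq; have powE (t : R) : expR (t * ln M) = M `^ t.
    by rewrite /powR (gt_eqF M0).
  rewrite powE; case: (leP x y) => [xy|/ltW yx].
    by rewrite ger0_norm ?subr_ge0 ?lef_pV2 ?posrE //; exact: cmp.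
  apply: (@le_trans _ _ (f y)); first exact: metric_mahler_anti.
  by rewrite ler_peMl // -(powRr0 M) ler_powR.
have e_cvg : e x @[x --> x0] --> 0.
  rewrite -[0](mul0r (ln M)) -(normr0 R) -(subrr x0^-1).
  apply: cvgM; last exact: cvg_cst.
  apply: cvg_norm; apply: cvgB; last exact: cvg_cst.
  by apply: cvgV; [rewrite gt_eqF | exact: cvg_id].
(* Used with [s] equal to -1 and 1, for the two sides of the squeeze. *)
have expe_cvg (s : R) : expR (s * e x) * f x0 @[x --> x0] --> f x0.
  have exp1 : expR (s * e x) @[x --> x0] --> (1 : R).
    rewrite -expR0 -(mulr0 s); apply: continuous_cvg; first exact: continuous_expR.
    by apply: cvgM => //; exact: cvg_cst.
  rewrite -[X in _ --> X]mul1r; apply: cvgM exp1 _; exact: cvg_cst.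
apply: (@squeeze_cvgr _ _ _ _ (fun x => expR (- 1 * e x) * f x0)
  (fun x => expR (1 * e x) * f x0)); last 2 first.
- exact: expe_cvg.
- exact: expe_cvg.
have x0q : x0 < x0 + 1 by rewrite ltrDl.
near=> x.
have x_gt0 : 0 < x by near: x; exact: lt_nbhsr.
have xq : x <= x0 + 1.
  by apply: ltW; near: x; exact: (lt_nbhsl x0q).
rewrite mul1r mulN1r expRN ler_pdivrMl ?expR_gt0 //; apply/andP; split.
  by have := cmp_e x0 x x0_gt0 x_gt0 (ltW x0q) xq; rewrite distrC.
exact: cmp_e x x0 x_gt0 x0_gt0 xq (ltW x0q).
Unshelve. all: by end_near. Qed.
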